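(* Let $\Lambda$ be a finite dimensional algebra over a field $K$ of rank $n\ge 2$ and let $\frac{A_0}{B_0}$ be an indecomposable balanced pair over $\Lambda$. If $A_0\neq0$, the covering wall $\mathcal{D}_\Lambda(M_-)$ of $g\left(\frac{A_0}{B_0}\right)$ has $M_-$ a quotient of $A_0$. If $B_0\ne0$, the flooring wall of $g\left(\frac{A_0}{B_0}\right)$ is $\mathcal{D}_\Lambda(M_+)$ where $M_+$ is (isomorphic to) a submodule of $B_0$.
   Context: Modules are finitely generated right $\Lambda$-modules; $S_1,\dots,S_n$ are the simple modules up to isomorphism and $n$ is the rank of $\Lambda$. $\underline{\dim}\,M\in\mathbb{Z}^n$ is the vector of multiplicities of the $S_i$ in a composition series of $M$. $\tau$ is the Auslander-Reiten translate. For $v,w\in\mathbb{R}^n$ put $v\ast w=\sum_i v_iw_i\dim_K S_i$, and $\eta=(1,\dots,1)$. Balanced pairs: a pair of modules, written $\frac{A}{B}$, is a balanced pair if (1) $\mathrm{Hom}_\Lambda(A,B)=0$; (2) $B\cong\tau A\sqcup I$ with $I$ injective; (3) $A\cong\tau^{-1}B\sqcup P$ with $P$ projective ($\sqcup$ is direct sum). Direct sums are componentwise (components may be zero); pairs are considered up to isomorphism and without repeated indecomposable summands. The indecomposable balanced pairs are $\frac{A}{\tau A}$ ($A$ indecomposable nonprojective $\tau$-rigid, where $\tau$-rigid means $\mathrm{Hom}_\Lambda(A,\tau A)=0$), $\frac{P}{0}$ ($P$ indecomposable projective), $\frac{0}{I}$ ($I$ indecomposable injective). A balanced pair is complete if it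 has $n$ nonisomorphic indecomposable summands. $g\left(\frac{A}{B}\right)=\underline{\dim}\,\mathrm{top}\,A-\underline{\dim}\,\mathrm{soc}\,B$. The Jasso category is $J\left(\frac{A}{B}\right)=\{X:\mathrm{Hom}(A,X)=0=\mathrm{Hom}(X,B)\}$; if $\frac{A}{B}$ has $n-1$ indecomposable summands, $J\left(\frac{A}{B}\right)$ has, up to isomorphism, a unique simple object. Chambers: for a nonzero module $M$, $\mathcal{D}_\Lambda(M)=\{v\in\mathbb{R}^n: v\ast\underline{\dim}M=0,\ v\ast\underline{\dim}M'\le 0\ \forall M'\subseteq M\}$. A chamber is a path component of $\mathbb{R}^n\setminus\bigcup_{M\neq0}\mathcal{D}_\Lambda(M)$. For a complete balanced pair with indecomposable summands $\frac{A_i}{B_i}$, its standard open chamber is the set of all $\sum r_i\,g\left(\frac{A_i}{B_i}\right)$, $r_i>0$ (it is a chamber); the wall of this chamber opposite $g\left(\frac{A_i}{B_i}\right)$ is $\mathcal{D}_\Lambda(N)$ where $N$ is the unique simple object of $J\left(\bigsqcup_{j\ne i}\frac{A_j}{B_j}\right)$ ($\mathcal{D}_\Lambda(N)$ contains the facet of the cone opposite $g\left(\frac{A_i}{B_i}\right)$). The upper chamber $\mathcal{B}_-$ (resp. lower chamber $\mathcal{B}_+$) of $v_0=g\left(\frac{A_0}{B_0}\right)$, for a non-complete pair, is the unique chamber with $v_0$ on its boundary which contains $v_0-\varepsilon\eta$ (resp. $v_0+\varepsilon\eta$) for all sufficiently small $\varepsilon>0$; these exist and are standard open chambers of complete balanced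 pairs having $\frac{A_0}{B_0}$ as a summand. Covering and flooring walls: if $A_0\neq0$, the covering wall of $v_0$ is the wall $\mathcal{D}_\Lambda(M_-)$ of $\mathcal{B}_-$ opposite $v_0$ (then $\mathcal{B}_-$ lies on its positive side, i.e. $x\ast\underline{\dim}M_->0$ for $x\in\mathcal{B}_-$). If $B_0\ne0$, the flooring wall of $v_0$ is the wall $\mathcal{D}_\Lambda(M_+)$ of $\mathcal{B}_+$ opposite $v_0$ (then $\mathcal{B}_+$ lies on its negative side). *)

(* Defs.v *)
From HB Require Import structures.
From mathcomp Require Import all_boot all_order all_algebra all_field.
From mathcomp Require Import all_classical all_reals topology normedtype.

Set Implicit Arguments.
Unset Strict Implicit.
Unset Printing Implicit Defensive.

Import Order.TTheory GRing.Theory Num.Theory numFieldNormedType.Exports.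

Local Open Scope classical_set_scope.
Local Open Scope ring_scope.

Variant side := Left | Right.

Definition opp_side (s : side) := if s is Left then Right else Left.

Section Modules.
Variables (K : fieldType) (L : falgType K).

(* [smul s a b] is the element acting as "first b, then a" on an s-sided
   module; every definition below is made once for both sides, so that the
   duality and the transpose go from one side to the other. *)
Definition smul (s : side) (a b : L) : L := if s is Left then a * b else b * a.

Fact smul_opp s a b : smul (opp_side s) a b = smul s b a.
Proof. by case: s. Qed.

(* Over a finite dimensional algebra the finitely generated modules are the
   finite dimensional ones. *)
Record module (s : side) := Module {
  carrier :> vectType K;
  act : L -> carrier -> carrier;
  act_linear : forall a, linear (act a);
  act_linear_l : forall x, linear (act^~ x);
  act1 : forall x, act 1 x = x;
  actM : forall a b x, act (smul s a b) x = act a (act b x) }.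

Arguments act {s} _.

HB.instance Definition _ s (M : module s) (a : L) :=
  GRing.isLinear.Build K M M *:%R (act M a) (act_linear a).

Definition nonzero s (M : module s) : Prop := (fullv : {vspace M}) <> 0%VS.

Definition is_hom s (M N : module s) (f : 'Hom(M, N)) : Prop :=
  forall a x, f (act M a x) = act N a (f x).

Definition mono s (M N : module s) (f : 'Hom(M, N)) : Prop :=
  is_hom f /\ lker f = 0%VS.

Definition epi s (M N : module s) (f : 'Hom(M, N)) : Prop :=
  is_hom f /\ limg f = fullv.

Definition iso s (M N : module s) : Prop :=
  exists f : 'Hom(M, N), mono f /\ epi f.

Definition hom_zero s (M N : module s) : Prop :=
  forall f : 'Hom(M, N), is_hom f -> f = 0.

Definition submodule_of s (N M : module s) : Prop :=
  exists f : 'Hom(N, M), mono f.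

Definition quotient_of s (N M : module s) : Prop :=
  exists f : 'Hom(M, N), epi f.

Definition stable s (M : module s) (U : {vspace M}) : Prop :=
  forall a x, x \in U -> act M a x \in U.

(* U and V are submodules of M, U <= V and V / U is simple. *)
Definition simple_factor s (M : module s) (U V : {vspace M}) : Prop :=
  [/\ stable U, stable V, (U <= V)%VS, U <> V &
      forall W : {vspace M}, stable W -> (U <= W)%VS -> (W <= V)%VS ->
        W = U \/ W = V].

Definition simple s (M : module s) : Prop :=
  simple_factor (0%VS : {vspace M}) fullv.

Lemma vspace_inf_exists (V : vectType K) (P : {vspace V} -> Prop) :
  exists U : {vspace V}, forall x, x \in U <-> forall W, P W -> x \in W.
Proof.
suff inf_below m (U : {vspace V}) : (\dim U <= m)%N ->
    (forall x, (forall W, P W -> x \in W) -> x \in U) ->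
    exists U : {vspace V}, forall x, x \in U <-> forall W, P W -> x \in W.
  by apply: (inf_below _ fullv (leqnn _)) => x _; rewrite memvf.
elim: m U => [|m IHm] U leUm infU;
  have [leUP | /existsNP[W /not_implyP[PW /negP nUW]]] :=
    pselect (forall W, P W -> (U <= W)%VS).
- by exists U => x; split=> [xU W /leUP/subvP/(_ x xU) | /infU].
- move: leUm; rewrite leqn0 dimv_eq0 => /eqP U0.
  by rewrite U0 sub0v in nUW.
- by exists U => x; split=> [xU W /leUP/subvP/(_ x xU) | /infU].
apply: (IHm (U :&: W)%VS) => [|x xP]; last by rewrite memv_cap infU //= xP.
rewrite -ltnS (leq_trans _ leUm) // ltn_neqAle dimvS ?capvSl // andbT.
by apply: contraNneq nUW => /eqP; rewrite (dimv_leqif_eq (capvSl U W)) =>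
  /eqP <-; apply: capvSr.
Qed.

Lemma vspace_sup_exists (V : vectType K) (P : {vspace V} -> Prop) :
  exists U : {vspace V}, (forall W, P W -> (W <= U)%VS) /\
    forall W : {vspace V}, (forall W', P W' -> (W' <= W)%VS) -> (U <= W)%VS.
Proof.
have [U infU] := vspace_inf_exists (fun U => forall W, P W -> (W <= U)%VS).
exists U; split=> [W PW | W ubW]; last by apply/subvP => x /infU; apply.
by apply/subvP => x xW; apply/infU => U' /(_ W PW)/subvP; apply.
Qed.

(* The intersection of the maximal submodules. *)
Definition radical s (M : module s) : {vspace M} :=
  xget 0%VS [set U : {vspace M} | forall x,
    x \in U <-> forall V : {vspace M}, simple_factor V fullv -> x \in V].

(* The sum of the simple submodules. *)
Definition socle s (M : module s) : {vspace M} :=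
  xget 0%VS [set U : {vspace M} |
    (forall V : {vspace M}, simple_factor 0 V -> (V <= U)%VS) /\
    forall W : {vspace M},
      (forall V : {vspace M}, simple_factor 0 V -> (V <= W)%VS) ->
      (U <= W)%VS].

Lemma radicalP s (M : module s) (x : M) :
  x \in radical M <-> forall V : {vspace M}, simple_factor V fullv -> x \in V.
Proof.
have [U radU] := vspace_inf_exists (fun V : {vspace M} => simple_factor V fullv).
by rewrite /radical; case: xgetP => [W _ /(_ x) // | /(_ U)]; case.
Qed.

Lemma socleP s (M : module s) :
  (forall V : {vspace M}, simple_factor 0 V -> (V <= socle M)%VS) /\
  forall W : {vspace M},
    (forall V : {vspace M}, simple_factor 0 V -> (V <= W)%VS) ->
    (socle M <= W)%VS.
Proof.
have [U socU] := vspace_sup_exists (fun V : {vspace M} => simple_factor 0 V).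
by rewrite /socle; case: xgetP => [W _ // | /(_ U)]; case.
Qed.

Definition projective s (P : module s) : Prop :=
  forall (X Y : module s) (g : 'Hom(X, Y)) (h : 'Hom(P, Y)),
    epi g -> is_hom h -> exists2 k : 'Hom(P, X), is_hom k & (g \o k)%VF = h.

Definition injective_module s (I : module s) : Prop :=
  forall (X Y : module s) (g : 'Hom(X, Y)) (h : 'Hom(X, I)),
    mono g -> is_hom h -> exists2 k : 'Hom(Y, I), is_hom k & (k \o g)%VF = h.

Definition superfluous s (M : module s) (U : {vspace M}) : Prop :=
  forall V : {vspace M}, stable V -> (U + V)%VS = fullv -> V = fullv.

(* P1 --f--> P0 --p--> M --> 0 is exact, and p : P0 -> M and
   f : P1 -> ker p are projective covers. *)
Definition minimal_presentation s (P1 P0 M : module s)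
    (f : 'Hom(P1, P0)) (p : 'Hom(P0, M)) : Prop :=
  [/\ projective P1, projective P0, is_hom f & epi p] /\
  [/\ limg f = lker p, superfluous (lker p) & superfluous (lker f)].

Section Regular.
Variable s : side.

Fact smul_linear (a : L) : linear (smul s a).
Proof.
by move=> k x y; case: (s); rewrite /smul ?mulrDr ?mulrDl -?scalerAr -?scalerAl.
Qed.

Fact smul_linear_l (x : L) : linear ((smul s)^~ x).
Proof.
by move=> k a b; case: (s); rewrite /smul ?mulrDr ?mulrDl -?scalerAr -?scalerAl.
Qed.

Fact smul1 (x : L) : smul s 1 x = x.
Proof. by case: (s); rewrite /smul ?mul1r ?mulr1. Qed.

Fact smulA (a b x : L) : smul s (smul s a b) x = smul s a (smul s b x).
Proof. by case: (s); rewrite /smul mulrA. Qed.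

Definition regular : module s :=
  @Module s L (smul s) smul_linear smul_linear_l smul1 smulA.

End Regular.

Section Dual.
Variables (s : side) (M : module s).

Definition dual_act (a : L) (xi : 'Hom(M, K^o)) : 'Hom(M, K^o) :=
  (xi \o linfun (act M a))%VF.

Fact dual_act_linear a : linear (dual_act a).
Proof. by move=> k x y; rewrite /dual_act comp_lfunDl comp_lfunZl. Qed.

Fact dual_act_linear_l xi : linear (dual_act^~ xi).
Proof.
move=> k a b; apply/lfunP=> x; rewrite add_lfunE scale_lfunE !comp_lfunE.
by rewrite !lfunE /= act_linear_l linearP.
Qed.

Fact dual_act1 xi : dual_act 1 xi = xi.
Proof. by apply/lfunP=> x; rewrite comp_lfunE lfunE /= act1. Qed.

Fact dual_actM a b xi :
  dual_act (smul (opp_side s) a b) xi = dual_act a (dual_act b xi).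
Proof.
by apply/lfunP=> x; rewrite !comp_lfunE !lfunE /= -actM smul_opp.
Qed.

Definition dual : module (opp_side s) :=
  Module dual_act_linear dual_act_linear_l dual_act1 dual_actM.

End Dual.

Section HomToRegular.
Variables (s : side) (P : module s).

Definition commutator (a : L) (f : 'Hom(P, regular s)) : 'Hom(P, regular s) :=
  (f \o linfun (act P a))%VF - (linfun (act (regular s) a) \o f)%VF.

Fact commutator_linear a : linear (commutator a).
Proof.
move=> k f g; rewrite /commutator comp_lfunDl -comp_lfunZl comp_lfunDr.
by rewrite -comp_lfunZr opprD addrACA scalerBr.
Qed.
HB.instance Definition _ a := GRing.isLinear.Build K 'Hom(P, regular s)
  'Hom(P, regular s) *:%R (commutator a) (commutator_linear a).

Lemma commutatorE a f x : commutator a f x = f (act P a x) - smul s a (f x).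
Proof. by rewrite add_lfunE opp_lfunE !comp_lfunE !lfunE. Qed.

Definition homs : {vspace 'Hom(P, regular s)} :=
  (\bigcap_(i < \dim {:L}) lker (linfun (commutator (vbasis {:L})`_i)))%VS.

Lemma homsP (f : 'Hom(P, regular s)) : f \in homs <-> is_hom f.
Proof.
rewrite memvE; split=> [/subv_bigcapP fK a x | hf].
  pose good b := f (act P b x) = smul s b (f x).
  have goodP k b c : good b -> good c -> good (k *: b + c).
    rewrite /good smul_linear_l => <- <-.
    by rewrite act_linear_l; apply: linearP.
  have good0 : good 0.
    have := act_linear_l x (-1) 0 0; have := smul_linear_l s (f x) (-1) 0 0.
    by rewrite /good !scaleN1r !addNr => -> ->; rewrite linear0.
  rewrite -/(good a) (coord_vbasis (memvf a)).
  apply: big_ind => // [b c | i _]; first by rewrite -{2}[b]scale1r; apply: goodP.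
  rewrite -[_ *: _]addr0; apply: goodP => //.
  have := fK i isT; rewrite -memvE memv_ker lfunE /=.
  move=> /eqP/lfunP/(_ x)/eqP.
  by rewrite commutatorE zero_lfunE subr_eq0 => /eqP.
apply/subv_bigcapP => i _; rewrite -memvE memv_ker lfunE /=; apply/eqP/lfunP=> x.
by rewrite commutatorE hf zero_lfunE subrr.
Qed.

(* (a . phi) x is a . (phi x) for the action of a on the other side of L. *)
Definition homs_act (a : L) (phi : subvs_of homs) : subvs_of homs :=
  vsproj homs (linfun (act (regular (opp_side s)) a) \o vsval phi)%VF.

Lemma homs_actE a phi x :
  vsval (homs_act a phi) x = smul (opp_side s) a (vsval phi x).
Proof.
rewrite /homs_act vsprojK ?comp_lfunE ?lfunE //; apply/homsP => b y.
have /homsP hphi := subvsP phi.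
by rewrite !comp_lfunE hphi !lfunE /= !smul_opp smulA.
Qed.

Fact homs_act_linear a : linear (homs_act a).
Proof.
move=> k f g; apply/subvs_inj/lfunP=> x.
rewrite linearP add_lfunE scale_lfunE !homs_actE -smul_linear.
by congr smul; rewrite -scale_lfunE -add_lfunE.
Qed.

Fact homs_act_linear_l phi : linear (homs_act^~ phi).
Proof.
move=> k a b; apply/subvs_inj/lfunP=> x.
by rewrite linearP add_lfunE scale_lfunE !homs_actE smul_linear_l.
Qed.

Fact homs_act1 phi : homs_act 1 phi = phi.
Proof. by apply/subvs_inj/lfunP=> x; rewrite /= homs_actE smul1. Qed.

Fact homs_actM a b phi :
  homs_act (smul (opp_side s) a b) phi = homs_act a (homs_act b phi).
Proof. by apply/subvs_inj/lfunP=> x; rewrite /= !homs_actE smulA. Qed.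

(* Hom_L (P, L) *)
Definition hom_regular : module (opp_side s) :=
  Module homs_act_linear homs_act_linear_l homs_act1 homs_actM.

End HomToRegular.

(* N is a transpose of M: for a minimal projective presentation
   P1 --f--> P0 --> M --> 0 there is an exact sequence
   Hom_L (P0, L) --(- \o f)--> Hom_L (P1, L) --q--> N --> 0. *)
Definition is_transpose s (M : module s) (N : module (opp_side s)) : Prop :=
  exists (P1 P0 : module s) (f : 'Hom(P1, P0)) (p : 'Hom(P0, M))
         (q : 'Hom(hom_regular P1, N)),
    [/\ minimal_presentation f p, epi q &
        forall phi : hom_regular P1, q phi = 0 <->
          exists psi : hom_regular P0, vsval phi = (vsval psi \o f)%VF].

Section DirectSum.
Variables (s : side) (M N : module s).

Definition dsum_act (a : L) (x : M * N) : M * N := (act M a x.1, act N a x.2).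

Fact dsum_act_linear a : linear (dsum_act a).
Proof. by move=> k x y; rewrite /dsum_act !linearP. Qed.

Fact dsum_act_linear_l x : linear (dsum_act^~ x).
Proof. by move=> k a b; rewrite /dsum_act !act_linear_l. Qed.

Fact dsum_act1 x : dsum_act 1 x = x.
Proof. by rewrite /dsum_act !act1; case: x. Qed.

Fact dsum_actM a b x : dsum_act (smul s a b) x = dsum_act a (dsum_act b x).
Proof. by rewrite /dsum_act !actM. Qed.

Definition dsum : module s :=
  Module dsum_act_linear dsum_act_linear_l dsum_act1 dsum_actM.

End DirectSum.

Section ZeroModule.
Variable s : side.

Definition zero_act (a : L) (x : 'rV[K]_0) := x.

Fact zero_act_linear a : linear (zero_act a). Proof. by []. Qed.

Fact zero_act_linear_l x : linear (zero_act^~ x).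
Proof. by move=> k a b; rewrite thinmx0 [RHS]thinmx0. Qed.

Fact zero_act1 x : zero_act 1 x = x. Proof. by []. Qed.

Fact zero_actM a b x : zero_act (smul s a b) x = zero_act a (zero_act b x).
Proof. by []. Qed.

Definition zero_module : module s :=
  Module zero_act_linear zero_act_linear_l zero_act1 zero_actM.

End ZeroModule.

Definition rmodule := module Right.

(* T is isomorphic to tau M = D Tr M. *)
Definition is_tau (M T : rmodule) : Prop :=
  exists2 N : module Left, @is_transpose Right M N & @iso Right T (dual N).

(* T is isomorphic to tau^{-1} M = Tr D M. *)
Definition is_tau_inv (M T : rmodule) : Prop := @is_transpose Left (dual M) T.

(* (A, B) stands for the pair written A over B. *)
Definition mpair := (rmodule * rmodule)%type.

Definition balanced (p : mpair) : Prop :=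
  [/\ hom_zero p.1 p.2,
      exists T I : rmodule,
        [/\ is_tau p.1 T, injective_module I & iso p.2 (dsum T I)] &
      exists T P : rmodule,
        [/\ is_tau_inv p.2 T, projective P & iso p.1 (dsum T P)]].

Definition pair_nonzero (p : mpair) : Prop := nonzero p.1 \/ nonzero p.2.

Definition pair_iso (p q : mpair) : Prop := iso p.1 q.1 /\ iso p.2 q.2.

Definition pair_sum (p q : mpair) : mpair := (dsum p.1 q.1, dsum p.2 q.2).

Definition pair_zero : mpair := (zero_module Right, zero_module Right).

(* Indecomposability is relative to balanced summands: A / tau A is the sum of
   the pairs A / 0 and 0 / tau A, which are not balanced in general. *)
Definition indecomposable_balanced (p : mpair) : Prop :=
  [/\ balanced p, pair_nonzero p &
      forall p1 p2 : mpair, balanced p1 -> balanced p2 ->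
        pair_iso p (pair_sum p1 p2) -> ~ pair_nonzero p1 \/ ~ pair_nonzero p2].

Definition jasso (p : mpair) (X : rmodule) : Prop :=
  hom_zero p.1 X /\ hom_zero X p.2.

(* The simple objects of the full subcategory of modules satisfying C, with
   monomorphisms taken in that subcategory. *)
Definition simple_object (C : rmodule -> Prop) (X : rmodule) : Prop :=
  [/\ C X, nonzero X &
      forall (Y : rmodule) (f : 'Hom(Y, X)), C Y -> is_hom f ->
        (forall (Z : rmodule) (g h : 'Hom(Z, Y)), C Z -> is_hom g -> is_hom h ->
          (f \o g)%VF = (f \o h)%VF -> g = h) ->
        ~ nonzero Y \/ (mono f /\ epi f)].

Definition simple_representatives n (S : 'I_n -> rmodule) : Prop :=
  [/\ forall i, simple (S i),
      forall i j, iso (S i) (S j) -> i = j &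
      forall M : rmodule, simple M -> exists i, iso M (S i)].

(* f induces an isomorphism from V / U to N. *)
Definition factor_iso s (M : module s) (U V : {vspace M}) (N : module s) : Prop :=
  exists f : 'Hom(M, N),
    [/\ forall a x, x \in V -> f (act M a x) = act N a (f x),
        (f @: V)%VS = fullv & (V :&: lker f)%VS = U].

(* U < V_1 < ... < V_l = V for c = [:: V_1; ...; V_l] *)
Definition composition_series s (M : module s) (U V : {vspace M})
    (c : seq {vspace M}) : Prop :=
  path (fun W W' => `[< simple_factor W W' >]) U c /\ last U c = V.

Lemma composition_series_exists s (M : module s) (U V : {vspace M}) :
  stable U -> stable V -> (U <= V)%VS -> exists c, composition_series U V c.
Proof.
move=> stU stV; have [m] := ubnP (\dim V - \dim U).
elim: m U stU => // m IHm U stU lt_m leUV.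
have [-> | neUV] := eqVneq U V; first by exists [::].
pose above d := `[< exists W : {vspace M},
  [/\ stable W, (U <= W)%VS, (W <= V)%VS, U <> W & \dim W = d] >].
have ex_above : exists d, above d.
  by exists (\dim V); apply/asboolP; exists V; split=> //; apply/eqP.
case: (ex_minnP ex_above) => d /asboolP[W [stW leUW leWV neUW dimW]] min_d.
have facW : simple_factor U W.
  split=> // X stX leUX leXW.
  have [-> | neXU] := eqVneq X U; [by left | right].
  apply/eqP; rewrite eqEdim leXW dimW min_d //; apply/asboolP; exists X.
  by split=> //; [apply: subv_trans leXW leWV | move/eqP; rewrite eq_sym (negPf neXU)].
have ltUW : (\dim U < \dim W)%N.
  rewrite ltn_neqAle dimvS // andbT; apply/eqP => eq_dim; apply: neUW.
  by apply/eqP; rewrite eqEdim leUW eq_dim leqnn.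
have [|c [pathc lastc]] := IHm W stW _ leWV.
  rewrite -ltnS (leq_trans _ lt_m) // ltnS ltn_sub2l //.
  by apply: leq_trans ltUW (dimvS leWV).
by exists (W :: c); split=> //=; rewrite pathc andbT; apply/asboolP.
Qed.

Section Chambers.
Variables (R : realType) (n : nat) (S : 'I_n -> rmodule).

(* The dimension vector of V / U, for submodules U <= V of M. *)
Definition dimv_factor (M : rmodule) (U V : {vspace M}) : 'rV[int]_n :=
  let c := xget [::] [set c | composition_series U V c] in
  \row_i (count (fun W => `[< factor_iso W.1 W.2 (S i) >]) (zip (U :: c) c))%:Z.

Definition dimv (M : rmodule) : 'rV[int]_n :=
  dimv_factor (0%VS : {vspace M}) fullv.

Definition gvec (p : mpair) : 'rV[int]_n :=
  dimv_factor (radical p.1) fullv - dimv_factor 0%VS (socle p.2).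

Definition real_vec (v : 'rV[int]_n) : 'rV[R]_n := map_mx intr v.

Definition star (v w : 'rV[R]_n) : R :=
  \sum_(i < n) v ord0 i * w ord0 i * (\dim (fullv : {vspace S i}))%:R.

Definition eta : 'rV[R]_n := const_mx 1.

Definition stability_domain (M : rmodule) : set 'rV[R]_n :=
  [set v | star v (real_vec (dimv M)) = 0 /\
    forall U : {vspace M}, stable U ->
      star v (real_vec (dimv_factor 0%VS U)) <= 0].

Definition wall_union : set 'rV[R]_n :=
  [set v | exists2 M : rmodule, nonzero M & stability_domain M v].

Definition path_joined (X : set 'rV[R]_n) (x y : 'rV[R]_n) : Prop :=
  exists gamma : R -> 'rV[R]_n,
    [/\ {within `[0, 1], continuous gamma}, gamma 0 = x, gamma 1 = y &
        forall t, t \in `[0, 1] -> X (gamma t)].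

Definition chamber (C : set 'rV[R]_n) : Prop :=
  exists2 x, (~` wall_union) x &
    C = [set y | path_joined (~` wall_union) x y].

Definition on_boundary (C : set 'rV[R]_n) (v : 'rV[R]_n) : Prop :=
  closure C v /\ ~ interior C v.

Definition upper_chamber (v : 'rV[R]_n) (C : set 'rV[R]_n) : Prop :=
  [/\ chamber C, on_boundary C v & \forall e \near 0^'+, C (v - e *: eta)].

Definition lower_chamber (v : 'rV[R]_n) (C : set 'rV[R]_n) : Prop :=
  [/\ chamber C, on_boundary C v & \forall e \near 0^'+, C (v + e *: eta)].

(* The family of the n indecomposable summands of a complete balanced pair. *)
Definition complete_balanced (q : 'I_n -> mpair) : Prop :=
  [/\ balanced (\big[pair_sum/pair_zero]_(i < n) q i),
      forall i, indecomposable_balanced (q i) &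
      forall i j, pair_iso (q i) (q j) -> i = j].

Definition standard_open_chamber (q : 'I_n -> mpair) : set 'rV[R]_n :=
  [set x | exists2 r : 'I_n -> R, forall i, 0 < r i &
     x = \sum_(i < n) r i *: real_vec (gvec (q i))].

(* stability_domain N is the wall of standard_open_chamber q opposite
   gvec (q i). *)
Definition opposite_wall (q : 'I_n -> mpair) (i : 'I_n) (N : rmodule) : Prop :=
  simple_object (jasso (\big[pair_sum/pair_zero]_(j < n | j != i) q j)) N.

(* stability_domain M is the covering wall of gvec p. *)
Definition covering_wall (p : mpair) (M : rmodule) : Prop :=
  exists (q : 'I_n -> mpair) (i : 'I_n),
    [/\ complete_balanced q, pair_iso (q i) p,
        upper_chamber (real_vec (gvec p)) (standard_open_chamber q) &
        opposite_wall q i M].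

(* stability_domain M is the flooring wall of gvec p. *)
Definition flooring_wall (p : mpair) (M : rmodule) : Prop :=
  exists (q : 'I_n -> mpair) (i : 'I_n),
    [/\ complete_balanced q, pair_iso (q i) p,
        lower_chamber (real_vec (gvec p)) (standard_open_chamber q) &
        opposite_wall q i M].

End Chambers.
End Modules.

(* Main.v *)
Require Import Defs.
From HB Require Import structures.
From mathcomp Require Import all_boot all_order all_algebra all_field.
From mathcomp Require Import all_classical all_reals topology normedtype.
From mathcomp Require Import zify ring lra.

Set Implicit Arguments.
Unset Strict Implicit.
Unset Printing Implicit Defensive.

Import Order.TTheory GRing.Theory Num.Theory.
Local Open Scope ring_scope.

(** For a balanced pair p = (A, B) put euler p X = dim Hom (A, X) -
    dim Hom (X, B). Write B = tau A + I with I injective, and let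
    P1 -> P0 -> A -> 0 be the minimal projective presentation behind tau A. The
    Auslander-Reiten formula turns euler p X into dim Hom (P0, X) -
    dim Hom (P1, X) - dim Hom (X, I), so euler p is additive on short exact
    sequences ([euler_additive]) and is determined by the composition factors of
    X. At a simple module S_k it is the k-th entry of the g-vector times
    dim End S_k ([gvec_euler]). Hence euler p X is the value at the g-vector of
    p of a linear form with nonnegative weights that depend on X only
    ([euler_gvec]).

    Let q be the complete pair whose chamber is the upper chamber of g (p), where
    p is isomorphic to q_i = (A_i, B_i). That chamber contains g (p) - e eta for
    some e > 0, so g (p) - e eta is a sum of the r_j g (q_j) with r_j > 0.
    Evaluate this relation at the simple object M of the Jasso category of the
    other summands. Their Euler forms vanish at M, and if Hom (A_i, M) were 0, the
    Euler form of q_i would be at most 0 there, which forces r_i > 1. Evaluate the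
    relation at A_i: all the Euler forms are nonnegative there, as
    Hom (A_i, B_j) = 0, and this forces r_i < 1. So there is a nonzero map A_i -> M
    ([hom_nonzero_above]). Its image belongs to the Jasso category, hence is M
    ([jasso_simple_quotient]).

    For the lower chamber, evaluation at M and at B_i gives a nonzero map
    M -> B_i ([hom_nonzero_below]). Its image belongs to the Jasso category, and
    additivity of the Euler forms shows that its kernel does too; as M is simple
    in that category, the kernel is 0 ([jasso_simple_submodule]). *)

(** * Linear algebra *)

#[local] Arguments act {K L s} m _ _.

Section LinearAlgebra.
Variable K : fieldType.

Lemma linear_lfun (V W : vectType K) (f : V -> W) :
  linear f -> exists g : 'Hom(V, W), forall x, g x = f x.
Proof.
move=> lf; pose F := HB.pack f (GRing.isLinear.Build K V W *:%R f lf)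
  : {linear V -> W}.
by exists (linfun F) => x; rewrite lfunE.
Qed.

Lemma bilinear_lfun (U V W : vectType K) (b : U -> V -> W) :
  (forall x, linear (b x)) -> (forall y, linear (b^~ y)) ->
  exists g : 'Hom(U, 'Hom(V, W)), forall x y, g x y = b x y.
Proof.
move=> lr ll; have [c cE] := choice (fun x => linear_lfun (lr x)).
have [|g gE] := @linear_lfun _ _ c; last by exists g => x y; rewrite gE cE.
by move=> k x y; apply/lfunP=> z; rewrite add_lfunE scale_lfunE !cE ll.
Qed.

(** Being a homomorphism is a Prop-valued condition; this turns such a condition
    into a subspace, which then has a dimension. *)
Definition vspace_of (V : vectType K) (P : V -> Prop) : {vspace V} :=
  xget 0%VS [set U : {vspace V} | forall x, x \in U <-> P x]%classic.

Lemma vspace_ofP (V : vectType K) (P : V -> Prop) :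
  P 0 -> (forall k x y, P x -> P y -> P (k *: x + y)) ->
  forall x, x \in vspace_of P <-> P x.
Proof.
move=> P0 PD; rewrite /vspace_of; case: xgetP => [U _ // | nU].
pose good d := `[< exists U : {vspace V},
  (forall x, x \in U -> P x) /\ \dim U = d >].
have ex_good : exists d, good d.
  exists 0%N; apply/asboolP; exists 0%VS; rewrite dimv0; split=> // x.
  by rewrite memv0 => /eqP ->.
have ub_good d : good d -> (d <= \dim {:V})%N.
  by move=> /asboolP[U [_ <-]]; rewrite dimvS ?subvf.
case: (ex_maxnP ex_good ub_good) => d /asboolP[U [PU dimU]] max_d.
suff /nU [] : forall x, x \in U <-> P x by [].
move=> x; split=> [/PU // | Px]; apply: contraT => xU.
have /max_d : good (\dim (U + <[x]>)).
  apply/asboolP; exists (U + <[x]>)%VS; split=> // y.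
  move=> /memv_addP[u uU [_ /vlineP[k ->] ->]].
  by rewrite addrC; apply: PD => //; apply: PU.
rewrite -dimU => le_dim; move: xU; rewrite memvE.
have /eqP -> : U == (U + <[x]>)%VS by rewrite eqEdim addvSl.
by rewrite addvSr.
Qed.

(** Exactness of 0 -> A -> B -> C -> 0 is spelled out elementwise, for plain
    linear functions, so that it applies to pre- and postcomposition on spaces
    of homomorphisms. *)
Lemma dim_exact (U V W : vectType K) (A : {vspace U}) (B : {vspace V})
    (C : {vspace W}) (f : U -> V) (g : V -> W) :
  linear f -> linear g ->
  (forall x, x \in A -> f x = 0 -> x = 0) ->
  (forall x, x \in A -> f x \in B /\ g (f x) = 0) ->
  (forall y, y \in B -> g y = 0 -> exists2 x, x \in A & f x = y) ->
  (forall y, y \in B -> g y \in C) ->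
  (forall z, z \in C -> exists2 y, y \in B & g y = z) ->
  \dim B = (\dim A + \dim C)%N.
Proof.
move=> /linear_lfun[F FE] /linear_lfun[G GE] injf fA kerg gB surjg.
rewrite -(limg_ker_dim G B); congr (_ + _)%N.
  have {1}-> : (B :&: lker G)%VS = (F @: A)%VS.
    apply/vspaceP=> y; rewrite memv_cap memv_ker.
    apply/andP/memv_imgP => [[yB /eqP] | [x xA ->]].
      by rewrite GE => /(kerg y yB)[x xA <-]; exists x; rewrite // FE.
    by have [fB gf] := fA x xA; rewrite FE GE gf fB eqxx.
  apply: limg_dim_eq; apply/eqP; rewrite -subv0; apply/subvP=> x.
  rewrite memv_cap memv_ker FE memv0 => /andP[xA /eqP fx].
  by apply/eqP/injf.
congr (\dim _); apply/vspaceP=> z; apply/memv_imgP/idP => [[y yB ->]|].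
  by rewrite GE gB.
by move=> /surjg[y yB <-]; exists y; rewrite // GE.
Qed.

Lemma dim_nondegenerate (U V : vectType K) (A : {vspace U}) (B : {vspace V})
    (b : U -> V -> K^o) :
  (forall y, linear (b^~ y)) -> (forall x, linear (b x)) ->
  (forall x, x \in A -> (forall y, y \in B -> b x y = 0) -> x = 0) ->
  (\dim A <= \dim B)%N.
Proof.
move=> ll lr nondeg.
have lF : linear (fun x => (\row_i b x (vbasis B)`_i) : 'rV[K]_(\dim B)).
  by move=> k x y; apply/rowP=> i; rewrite !mxE ll.
have [F FE] := linear_lfun lF.
have <- : \dim (F @: A) = \dim A.
  apply: limg_dim_eq; apply/eqP; rewrite -subv0; apply/subvP=> x.
  rewrite memv_cap memv_ker FE memv0 => /andP[xA /eqP/rowP Fx].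
  apply/eqP/nondeg => // y /coord_vbasis ->.
  have [g gE] := linear_lfun (lr x).
  rewrite -gE linear_sum big1 // => i _; rewrite linearZ /= gE.
  by have := Fx i; rewrite !mxE => ->; rewrite scaler0.
by rewrite (leq_trans (dimvS (subvf _))) // dimvf dim_matrix mul1r.
Qed.

(** A pairing between A and B which is nondegenerate on the left identifies A
    with the dual of B modulo the right kernel. *)
Lemma dim_pairing (U V : vectType K) (A : {vspace U}) (B C : {vspace V})
    (b : U -> V -> K^o) :
  (forall y, linear (b^~ y)) -> (forall x, linear (b x)) ->
  (forall x, x \in A -> (forall y, y \in B -> b x y = 0) -> x = 0) ->
  (forall y, y \in B -> y \in C <-> (forall x, x \in A -> b x y = 0)) ->
  (C <= B)%VS ->
  (\dim A + \dim C = \dim B)%N.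
Proof.
move=> ll lr nondeg kerC leCB.
have capBC : (B :&: C)%VS = C by apply/capv_idPr.
have dimD := dimv_cap_compl B C; rewrite capBC in dimD.
rewrite -dimD addnC; congr (_ + _)%N; apply/eqP; rewrite eqn_leq.
apply/andP; split.
  apply: (dim_nondegenerate ll lr) => x xA bx; apply: nondeg => // y yB.
  have [g gE] := linear_lfun (lr x).
  move: yB; rewrite -(addv_diff_cap B C) => /memv_addP[d dD [c]].
  rewrite capBC => cC ->; rewrite -gE linearD /= !gE bx // add0r.
  by apply: (kerC c _).1 => //; apply: (subvP leCB).
apply: (@dim_nondegenerate _ _ _ _ (fun y x => b x y)) => // y yD by0.
have yB : y \in B by apply: (subvP (diffvSl B C)).
apply/eqP; rewrite -memv0 -(capv_diff B C) memv_cap yD /=.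
by apply/(kerC y yB).
Qed.

Lemma separating_functional (V : vectType K) (U : {vspace V}) (x : V) :
  x \notin U ->
  exists t : 'Hom(V, K^o), t x <> 0 /\ forall y, y \in U -> t y = 0.
Proof.
move=> xU; pose p := (\1 - projv U)%VF.
have pE y : p y = y - projv U y by rewrite add_lfunE opp_lfunE id_lfunE.
have px : p x != 0.
  by apply: contraNneq xU => /eqP; rewrite pE subr_eq0 => /eqP ->;
     apply: memv_proj.
have [i ci] : exists i, coord (vbasis {:V}) i (p x) <> 0.
  apply: contrapT => /forallNP c0; case/eqP: px.
  rewrite (coord_vbasis (memvf (p x))) big1 // => i _.
  by rewrite (contrapT (c0 i)) scale0r.
have [t tE] : exists t : 'Hom(V, K^o),
    forall y, t y = coord (vbasis {:V}) i y.
  by apply: linear_lfun => k y z; rewrite linearD linearZ.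
exists (t \o p)%VF; rewrite comp_lfunE tE; split=> // y yU.
by rewrite comp_lfunE tE pE projv_id // subrr linear0.
Qed.

Lemma section_on (V W : vectType K) (f : 'Hom(V, W)) (U : {vspace V}) :
  (f @: U)%VS = fullv ->
  exists t : 'Hom(W, V), forall y, t y \in U /\ f (t y) = y.
Proof.
move=> fU; pose g := (f \o projv U)%VF.
have gsurj y : y \in limg g by rewrite /g limg_comp limg_proj fU memvf.
exists (projv U \o g^-1)%VF => y; rewrite comp_lfunE memv_proj; split=> //.
by have := limg_lfunVK (gsurj y); rewrite /g comp_lfunE.
Qed.

End LinearAlgebra.

(** * Submodules, quotients and dimensions of Hom spaces *)

Section Homs.
Variables (K : fieldType) (L : falgType K) (s : side).
Implicit Types M N P Q X Y : module L s.

Fact comp_linear_r (U V W : vectType K) (g : 'Hom(V, W)) :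
  linear (fun h : 'Hom(U, V) => (g \o h)%VF).
Proof. by move=> k x y; rewrite comp_lfunDr comp_lfunZr. Qed.

Fact comp_linear_l (U V W : vectType K) (h : 'Hom(U, V)) :
  linear (fun g : 'Hom(V, W) => (g \o h)%VF).
Proof. by move=> k x y; rewrite comp_lfunDl comp_lfunZl. Qed.

Lemma is_hom0 M N : is_hom (0 : 'Hom(M, N)).
Proof. by move=> a x; rewrite !zero_lfunE linear0. Qed.

Lemma is_hom_linear M N k (f g : 'Hom(M, N)) :
  is_hom f -> is_hom g -> is_hom (k *: f + g).
Proof.
by move=> hf hg a x; rewrite !add_lfunE !scale_lfunE hf hg linearP.
Qed.

Lemma is_hom_id M : is_hom (\1%VF : 'Hom(M, M)).
Proof. by move=> a x; rewrite !id_lfunE. Qed.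

Lemma is_hom_comp M N P (g : 'Hom(N, P)) (f : 'Hom(M, N)) :
  is_hom g -> is_hom f -> is_hom (g \o f)%VF.
Proof. by move=> hg hf a x; rewrite !comp_lfunE hf hg. Qed.

Lemma stable0 M : stable (0%VS : {vspace M}).
Proof. by move=> a x; rewrite memv0 => /eqP ->; rewrite linear0 mem0v. Qed.

Lemma stablef M : stable (fullv : {vspace M}).
Proof. by move=> a x _; rewrite memvf. Qed.

Lemma stable_cap M (U V : {vspace M}) :
  stable U -> stable V -> stable (U :&: V)%VS.
Proof.
by move=> stU stV a x; rewrite !memv_cap => /andP[/(stU a)-> /(stV a)->].
Qed.

Lemma stable_add M (U V : {vspace M}) :
  stable U -> stable V -> stable (U + V)%VS.
Proof.
move=> stU stV a _ /memv_addP[u uU [v vV ->]].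
by rewrite linearD memv_add ?stU ?stV.
Qed.

Lemma stable_img M N (f : 'Hom(M, N)) (U : {vspace M}) :
  is_hom f -> stable U -> stable (f @: U)%VS.
Proof.
by move=> hf stU a _ /memv_imgP[x xU ->]; rewrite -hf memv_img ?stU.
Qed.

Lemma stable_preim M N (f : 'Hom(M, N)) (U : {vspace N}) :
  is_hom f -> stable U -> stable (f @^-1: U)%VS.
Proof. by move=> hf stU a x; rewrite -!memv_preim hf => /stU. Qed.

Lemma stable_ker M N (f : 'Hom(M, N)) : is_hom f -> stable (lker f).
Proof.
by move=> hf; rewrite -lpreim0; apply: stable_preim => //; apply: stable0.
Qed.

Lemma mono_inj M N (f : 'Hom(M, N)) x y : mono f -> f x = f y -> x = y.
Proof. by case=> _ /eqP/lker0P; apply. Qed.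

Lemma mono_comp M N P (g : 'Hom(N, P)) (f : 'Hom(M, N)) :
  mono g -> mono f -> mono (g \o f)%VF.
Proof.
move=> mg mf; have [[hg _] [hf _]] := (mg, mf); split; first exact: is_hom_comp.
apply/eqP/lker0P => x y; rewrite !comp_lfunE.
by move=> /(mono_inj mg)/(mono_inj mf).
Qed.

Lemma epi_surj M N (f : 'Hom(M, N)) y : epi f -> exists x, f x = y.
Proof.
case=> _ fE; have : y \in limg f by rewrite fE memvf.
by case/memv_imgP=> x _ ->; exists x.
Qed.

Lemma epi_comp M N P (g : 'Hom(N, P)) (f : 'Hom(M, N)) :
  epi g -> epi f -> epi (g \o f)%VF.
Proof.
by case=> hg gE [hf fE]; split; [apply: is_hom_comp | rewrite limg_comp fE].
Qed.

Lemma mono_factor M N P (f : 'Hom(N, P)) (h : 'Hom(M, P)) :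
  mono f -> is_hom h -> (limg h <= limg f)%VS ->
  exists2 k : 'Hom(M, N), is_hom k & (f \o k)%VF = h.
Proof.
move=> mf hh le_hf; have fK x : f (f^-1%VF (h x)) = h x.
  by apply: limg_lfunVK; apply: (subvP le_hf); apply: memv_img; apply: memvf.
exists (f^-1 \o h)%VF; last by apply/lfunP=> x; rewrite !comp_lfunE fK.
move=> a x; rewrite !comp_lfunE; apply: (mono_inj mf).
by rewrite (proj1 mf) !fK hh.
Qed.

Lemma epi_factor M N P (g : 'Hom(M, N)) (h : 'Hom(M, P)) :
  epi g -> is_hom h -> (lker g <= lker h)%VS ->
  exists2 k : 'Hom(N, P), is_hom k & (k \o g)%VF = h.
Proof.
move=> eg hh le_gh; have hK x : h (g^-1%VF (g x)) = h x.
  have gK : g (g^-1%VF (g x)) = g x.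
    by apply: limg_lfunVK; apply: memv_img; apply: memvf.
  apply/eqP; rewrite -subr_eq0 -linearB /= -memv_ker (subvP le_gh) //.
  by rewrite memv_ker linearB /= gK subrr.
exists (h \o g^-1)%VF; last by apply/lfunP=> x; rewrite !comp_lfunE hK.
move=> a y; have [x <-] := epi_surj y eg.
by rewrite !comp_lfunE -(proj1 eg) !hK.
Qed.

Lemma iso_sym M N : iso M N -> iso N M.
Proof.
case=> f [mf ef]; have [|k hk fk] := mono_factor mf (@is_hom_id N).
  by rewrite (proj2 ef) subvf.
have kf : (k \o f)%VF = \1%VF.
  apply/lfunP=> x; apply: (mono_inj mf); rewrite comp_lfunE id_lfunE.
  by have /lfunP/(_ (f x)) := fk; rewrite comp_lfunE id_lfunE.
exists k; split; split=> //.
  apply/eqP/lker0P => x y kxy.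
  by rewrite -[x]id_lfunE -[y]id_lfunE -fk !comp_lfunE kxy.
apply/eqP; rewrite eqEsubv subvf /=; apply/subvP=> x _.
by rewrite -[x]id_lfunE -kf comp_lfunE memv_img ?memvf.
Qed.

(** Submodules and quotients are both carried by a space V with maps
    V -> M -> V composing to the identity. The hypothesis [rM] holds if the image
    of i is stable, which gives a submodule, and also if the kernel of r is stable,
    which gives a quotient. *)
Section Retract.
Variables (M : module L s) (V : vectType K) (i : 'Hom(V, M)) (r : 'Hom(M, V)).
Hypothesis rK : forall x, r (i x) = x.
Hypothesis rM : forall a b x,
  r (act M a (i (r (act M b (i x))))) = r (act M a (act M b (i x))).

Definition retract_act a x := r (act M a (i x)).

Fact retract_act_linear a : linear (retract_act a).
Proof. by move=> k x y; rewrite /retract_act !linearP. Qed.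

Fact retract_act_linear_l x : linear (retract_act^~ x).
Proof. by move=> k a b; rewrite /retract_act act_linear_l linearP. Qed.

Fact retract_act1 x : retract_act 1 x = x.
Proof. by rewrite /retract_act act1. Qed.

Fact retract_actM a b x :
  retract_act (smul s a b) x = retract_act a (retract_act b x).
Proof. by rewrite /retract_act rM actM. Qed.

Definition retract : module L s :=
  Module retract_act_linear retract_act_linear_l retract_act1 retract_actM.

End Retract.

Lemma submodule_exists M (U : {vspace M}) : stable U ->
  exists (N : module L s) (f : 'Hom(N, M)), mono f /\ limg f = U.
Proof.
move=> stU.
have [i iE] := @linear_lfun _ (subvs_of U) M vsval (@vsval_is_linear _ _ U).
have [r rE] := linear_lfun (@vsproj_is_linear _ M U).
have rK x : r (i x) = x by rewrite iE rE vsvalK.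
have iK x : x \in U -> i (r x) = x by move=> xU; rewrite iE rE vsprojK.
have iU x : i x \in U by rewrite iE subvsP.
have rM a b x :
    r (act M a (i (r (act M b (i x))))) = r (act M a (act M b (i x))).
  by rewrite [i (r _)]iK // stU.
exists (retract rK rM), i; split; first split.
- by move=> a x; rewrite /= iK ?stU.
- by apply/eqP/lker0P=> x y /(congr1 r); rewrite !rK.
apply/vspaceP=> x; apply/memv_imgP/idP => [[y _ ->] // | xU].
by exists (r x); rewrite ?memvf ?iK.
Qed.

Lemma quotient_exists M (U : {vspace M}) : stable U ->
  exists (Q : module L s) (g : 'Hom(M, Q)), epi g /\ lker g = U.
Proof.
move=> stU; pose p : 'Hom(M, M) := (\1 - projv U)%VF.
have pE y : p y = y - projv U y by rewrite add_lfunE opp_lfunE id_lfunE.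
have pC y : p y \in (U^C)%VS by rewrite pE memv_projC.
have p0 y : y \in U -> p y = 0 by move=> yU; rewrite pE projv_id ?subrr.
have p_id y : y \in (U^C)%VS -> p y = y.
  by rewrite -lker_proj memv_ker pE => /eqP ->; rewrite subr0.
have [i iE] := @linear_lfun _ (subvs_of U^C) M vsval (@vsval_is_linear _ _ U^C).
have [r' rE] := linear_lfun (@vsproj_is_linear _ M U^C).
pose r := (r' \o p)%VF; have ir x : i (r x) = p x.
  by rewrite comp_lfunE iE rE vsprojK.
have rK x : r (i x) = x by rewrite comp_lfunE iE rE p_id ?subvsP // vsvalK.
have kerr x : x \in lker r = (x \in U).
  rewrite memv_ker; apply/eqP/idP => [rx0 | xU].
    have /eqP : p x = 0 by rewrite -ir rx0 linear0.
    by rewrite pE subr_eq0 => /eqP ->; rewrite memv_proj.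
  by rewrite comp_lfunE p0 ?linear0.
have rp a x : r (act M a (p x)) = r (act M a x).
  apply/eqP; rewrite -subr_eq0 -linearB -linearB /= -memv_ker kerr.
  by rewrite stU // pE addrAC subrr sub0r memvN memv_proj.
have rM a b x :
    r (act M a (i (r (act M b (i x))))) = r (act M a (act M b (i x))).
  by rewrite ir rp.
exists (retract rK rM), r; split; last exact/vspaceP/kerr.
split=> [a x|]; first by rewrite /= /retract_act ir rp.
apply/eqP; rewrite eqEsubv subvf; apply/subvP=> x _.
by rewrite -[x]rK memv_img ?memvf.
Qed.

Definition hom_space M N : {vspace 'Hom(M, N)} := vspace_of (@is_hom K L s M N).

Lemma hom_spaceP M N (f : 'Hom(M, N)) : f \in hom_space M N <-> is_hom f.
Proof.
apply: vspace_ofP; first exact: is_hom0.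
by move=> k x y; apply: is_hom_linear.
Qed.

Definition hdim M N : nat := \dim (hom_space M N).

Lemma hdim_eq0 M N : hdim M N = 0%N <-> hom_zero M N.
Proof.
split=> [/eqP | h0].
  rewrite dimv_eq0 => /eqP h0 f /hom_spaceP; rewrite h0 memv0.
  by move/eqP.
apply/eqP; rewrite dimv_eq0 -subv0; apply/subvP=> f /hom_spaceP/h0 ->.
by rewrite mem0v.
Qed.

Lemma not_hom_zero M N :
  ~ hom_zero M N -> exists2 f : 'Hom(M, N), is_hom f & f <> 0.
Proof. by move=> /existsNP[f /not_implyP[hf f0]]; exists f. Qed.

Lemma nonzero_vec M : nonzero M <-> exists x : M, x <> 0.
Proof.
split=> [nz | [x x0] /vspaceP/(_ x)]; last first.
  by rewrite memvf memv0 => /esym/eqP.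
apply: contrapT => /forallNP all0; apply: nz; apply/eqP.
rewrite -subv0; apply/subvP=> x _; rewrite memv0; apply/eqP.
exact: contrapT (all0 x).
Qed.

Lemma hdim_gt0 M : nonzero M -> (0 < hdim M M)%N.
Proof.
move=> /nonzero_vec[x x0]; rewrite lt0n; apply/eqP.
move=> /hdim_eq0/(_ _ (@is_hom_id M)).
by move=> /lfunP/(_ x); rewrite id_lfunE zero_lfunE.
Qed.

Definition short_exact N M Q (f : 'Hom(N, M)) (g : 'Hom(M, Q)) : Prop :=
  [/\ mono f, epi g & limg f = lker g].

Lemma short_exact_of_stable M (U : {vspace M}) : stable U ->
  exists (N Q : module L s) (f : 'Hom(N, M)) (g : 'Hom(M, Q)),
    short_exact f g /\ limg f = U.
Proof.
move=> stU; have [N [f [mf fU]]] := submodule_exists stU.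
have [Q [g [eg gU]]] := quotient_exists stU.
by exists N, Q, f, g; split=> //; split=> //; rewrite fU gU.
Qed.

Lemma hdim_projective P N M Q (f : 'Hom(N, M)) (g : 'Hom(M, Q)) :
  projective P -> short_exact f g -> hdim P M = (hdim P N + hdim P Q)%N.
Proof.
move=> projP [mf eg fg].
have gf x : g (f x) = 0.
  by apply/eqP; rewrite -memv_ker -fg memv_img ?memvf.
apply: (dim_exact (comp_linear_r f) (comp_linear_r g)).
- move=> h _ /lfunP fh0; apply/lfunP=> x; apply: (mono_inj mf).
  by rewrite -comp_lfunE fh0 !zero_lfunE linear0.
- move=> h /hom_spaceP hh; split.
    by apply/hom_spaceP/is_hom_comp => //; case: mf.
  by apply/lfunP=> x; rewrite !comp_lfunE gf zero_lfunE.
- move=> h /hom_spaceP hh gh0.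
  have [|k hk <-] := mono_factor mf hh.
    rewrite fg; apply/subvP=> _ /memv_imgP[x _ ->].
    by rewrite memv_ker -comp_lfunE gh0 zero_lfunE.
  by exists k; first apply/hom_spaceP.
- by move=> h /hom_spaceP hh; apply/hom_spaceP/is_hom_comp => //; case: eg.
move=> h /hom_spaceP /(projP _ _ _ _ eg)[k hk <-].
by exists k; first apply/hom_spaceP.
Qed.

Lemma hdim_injective I N M Q (f : 'Hom(N, M)) (g : 'Hom(M, Q)) :
  injective_module I -> short_exact f g -> hdim M I = (hdim N I + hdim Q I)%N.
Proof.
move=> injI [mf eg fg]; rewrite addnC.
have gf x : g (f x) = 0.
  by apply/eqP; rewrite -memv_ker -fg memv_img ?memvf.
apply: (dim_exact (comp_linear_l g) (comp_linear_l f)).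
- move=> h _ /lfunP hg0; apply/lfunP=> y; have [x <-] := epi_surj y eg.
  by rewrite -comp_lfunE hg0 !zero_lfunE.
- move=> h /hom_spaceP hh; split.
    by apply/hom_spaceP/is_hom_comp => //; case: eg.
  by apply/lfunP=> x; rewrite !comp_lfunE gf zero_lfunE linear0.
- move=> h /hom_spaceP hh hf0.
  have [|k hk <-] := epi_factor eg hh.
    rewrite -fg; apply/subvP=> _ /memv_imgP[x _ ->].
    by rewrite memv_ker -comp_lfunE hf0 zero_lfunE.
  by exists k; first apply/hom_spaceP.
- by move=> h /hom_spaceP hh; apply/hom_spaceP/is_hom_comp => //; case: mf.
move=> h /hom_spaceP /(injI _ _ _ _ mf)[k hk <-].
by exists k; first apply/hom_spaceP.
Qed.

Lemma hdim_epi_le M M' N (g : 'Hom(M, M')) : epi g -> (hdim M' N <= hdim M N)%N.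
Proof.
move=> eg; have [c cE] := linear_lfun (@comp_linear_l _ _ N g).
rewrite /hdim -(@limg_dim_eq _ _ _ c (hom_space M' N)).
  apply/dimvS/subvP=> _ /memv_imgP[h /hom_spaceP hh ->].
  by rewrite cE; apply/hom_spaceP/is_hom_comp => //; case: eg.
apply/eqP; rewrite -subv0; apply/subvP=> h; rewrite memv_cap memv_ker cE memv0.
case/andP=> _ /eqP/lfunP hg0; apply/eqP/lfunP=> y; have [x <-] := epi_surj y eg.
by rewrite -comp_lfunE hg0 !zero_lfunE.
Qed.

Lemma hdim_mono_le M N N' (f : 'Hom(N, N')) :
  mono f -> (hdim M N <= hdim M N')%N.
Proof.
move=> mf; have [c cE] := linear_lfun (@comp_linear_r M _ _ f).
rewrite /hdim -(@limg_dim_eq _ _ _ c (hom_space M N)).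
  apply/dimvS/subvP=> _ /memv_imgP[h /hom_spaceP hh ->].
  by rewrite cE; apply/hom_spaceP/is_hom_comp => //; case: mf.
apply/eqP; rewrite -subv0; apply/subvP=> h; rewrite memv_cap memv_ker cE memv0.
case/andP=> _ /eqP/lfunP fh0; apply/eqP/lfunP=> x; apply: (mono_inj mf).
by rewrite -comp_lfunE fh0 !zero_lfunE linear0.
Qed.

Lemma hdim_isol M M' N : iso M M' -> hdim M N = hdim M' N.
Proof.
move=> isoM; have [f [_ ef]] := isoM; have [g [_ eg]] := iso_sym isoM.
by apply/eqP; rewrite eqn_leq (hdim_epi_le N ef) (hdim_epi_le N eg).
Qed.

Lemma hdim_isor M N N' : iso N N' -> hdim M N = hdim M N'.
Proof.
move=> isoN; have [f [mf _]] := isoN; have [g [mg _]] := iso_sym isoN.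
by apply/eqP; rewrite eqn_leq (hdim_mono_le M mf) (hdim_mono_le M mg).
Qed.

Lemma pair_lfun (M N N' : vectType K) (f : 'Hom(M, N)) (g : 'Hom(M, N')) :
  exists h : 'Hom(M, (N * N')%type), forall x, h x = (f x, g x).
Proof. by apply: linear_lfun => k x y; rewrite !linearP. Qed.

Lemma proj_lfun (N N' : vectType K) :
  exists (p : 'Hom((N * N')%type, N)) (q : 'Hom((N * N')%type, N')),
    forall x, p x = x.1 /\ q x = x.2.
Proof.
have [p pE] := @linear_lfun K (N * N')%type N fst ltac:(by []).
have [q qE] := @linear_lfun K (N * N')%type N' snd ltac:(by []).
by exists p, q.
Qed.

Lemma hdim_dsum M N N' : hdim M (dsum N N') = (hdim M N + hdim M N')%N.
Proof.
have [p [q pq]] := proj_lfun N N'.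
have [i iE] := pair_lfun (\1%VF : 'Hom(N, N)) (0 : 'Hom(N, N')).
pose f : 'Hom(N, dsum N N') := i; pose g : 'Hom(dsum N N', N') := q.
have fE x : f x = (x, 0) by rewrite /f iE id_lfunE zero_lfunE.
have gE x : g x = x.2 by case: (pq x).
have hf : is_hom f by move=> a x; rewrite !fE /= /dsum_act linear0.
have hg : is_hom g by move=> a x; rewrite !gE.
apply: (dim_exact (comp_linear_r f) (comp_linear_r g)).
- move=> h _ /lfunP fh0; apply/lfunP=> x.
  by have := fh0 x; rewrite comp_lfunE fE !zero_lfunE => -[].
- move=> h /hom_spaceP hh; split; first exact/hom_spaceP/is_hom_comp.
  by apply/lfunP=> x; rewrite !comp_lfunE gE fE zero_lfunE.
- move=> h /hom_spaceP hh /lfunP gh0; pose k : 'Hom(M, N) := (p \o h)%VF.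
  have kE x : k x = (h x).1 by rewrite comp_lfunE; case: (pq (h x)).
  exists k; first by apply/hom_spaceP=> a x; rewrite !kE hh.
  apply/lfunP=> x; rewrite comp_lfunE fE kE; move: (gh0 x).
  by rewrite comp_lfunE gE zero_lfunE; case: (h x) => a b /= ->.
- by move=> h /hom_spaceP hh; apply/hom_spaceP/is_hom_comp.
move=> h /hom_spaceP hh; have [k kE] := pair_lfun (0 : 'Hom(M, N)) h.
exists k; last by apply/lfunP=> x; rewrite comp_lfunE gE kE.
by apply/hom_spaceP=> a x; rewrite !kE !zero_lfunE hh /= /dsum_act linear0.
Qed.

Lemma hdim_dsuml M M' N : hdim (dsum M M') N = (hdim M N + hdim M' N)%N.
Proof.
have [p [q pq]] := proj_lfun M M'.
have [i iE] := pair_lfun (\1%VF : 'Hom(M, M)) (0 : 'Hom(M, M')).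
have [j jE] := pair_lfun (0 : 'Hom(M', M)) (\1%VF : 'Hom(M', M')).
pose f : 'Hom(M, dsum M M') := i; pose g : 'Hom(dsum M M', M') := q.
pose f' : 'Hom(M', dsum M M') := j; pose g' : 'Hom(dsum M M', M) := p.
have fE x : f x = (x, 0) by rewrite /f iE id_lfunE zero_lfunE.
have f'E x : f' x = (0, x) by rewrite /f' jE id_lfunE zero_lfunE.
have gE x : g x = x.2 by case: (pq x).
have g'E x : g' x = x.1 by case: (pq x).
have hf : is_hom f by move=> a x; rewrite !fE /= /dsum_act linear0.
have hg : is_hom g by move=> a x; rewrite !gE.
have hf' : is_hom f' by move=> a x; rewrite !f'E /= /dsum_act linear0.
have hg' : is_hom g' by move=> a x; rewrite !g'E.
have dec x : x = f (g' x) + f' (g x).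
  rewrite fE f'E gE g'E; case: x => a b /=.
  by congr (_, _); rewrite ?addr0 ?add0r.
rewrite addnC; apply: (dim_exact (comp_linear_l g) (comp_linear_l f)).
- move=> h _ /lfunP hg0; apply/lfunP=> x.
  by have := hg0 (f' x); rewrite comp_lfunE gE f'E !zero_lfunE.
- move=> h /hom_spaceP hh; split; first exact/hom_spaceP/is_hom_comp.
  by apply/lfunP=> x; rewrite !comp_lfunE gE fE zero_lfunE linear0.
- move=> h /hom_spaceP hh /lfunP hf0; exists (h \o f')%VF.
    exact/hom_spaceP/is_hom_comp.
  apply/lfunP=> x; rewrite [in RHS](dec x) linearD /= -[h (f _)]comp_lfunE.
  by rewrite hf0 zero_lfunE add0r !comp_lfunE.
- by move=> h /hom_spaceP hh; apply/hom_spaceP/is_hom_comp.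
move=> h /hom_spaceP hh; exists (h \o g')%VF; first exact/hom_spaceP/is_hom_comp.
by apply/lfunP=> x; rewrite !comp_lfunE g'E fE.
Qed.

End Homs.

(** * Projective modules and the Auslander-Reiten formula *)

Section FreeModule.
Variables (K : fieldType) (L : falgType K) (s : side) (m : nat).

Definition free_act (a : L) (x : {ffun 'I_m -> L}) : {ffun 'I_m -> L} :=
  [ffun i => smul s a (x i)].

Fact free_act_linear a : linear (free_act a).
Proof. by move=> k x y; apply/ffunP=> i; rewrite !ffunE smul_linear. Qed.

Fact free_act_linear_l x : linear (free_act^~ x).
Proof. by move=> k a b; apply/ffunP=> i; rewrite !ffunE smul_linear_l. Qed.

Fact free_act1 x : free_act 1 x = x.
Proof. by apply/ffunP=> i; rewrite !ffunE smul1. Qed.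

Fact free_actM a b x : free_act (smul s a b) x = free_act a (free_act b x).
Proof. by apply/ffunP=> i; rewrite !ffunE smulA. Qed.

Definition free_module : module L s :=
  Module free_act_linear free_act_linear_l free_act1 free_actM.

End FreeModule.

Section DualBasis.
Variables (K : fieldType) (L : falgType K) (s : side).
Implicit Types P X : module L s.

(** The dual basis lemma. The identity of P lifts through the free module on a
    K-basis of P, and the coordinates of the lift are the forms [phi i]. *)
Lemma dual_basis P : projective P ->
  exists (m : nat) (e : 'I_m -> P) (phi : 'I_m -> hom_regular P),
    forall x, x = \sum_i act P (vsval (phi i) x) (e i).
Proof.
move=> projP; pose m := \dim {:P}; pose e (i : 'I_m) : P := (vbasis {:P})`_i.
pose F := free_module L s m.
have act_l (M : module L s) k a b (x : M) :
    act M (k *: a + b) x = k *: act M a x + act M b x.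
  exact: act_linear_l.
have act_0l (M : module L s) (x : M) : act M 0 x = 0.
  by rewrite -(addNr (0 : L)) -scaleN1r act_l scaleN1r addNr.
have [g gE] : exists g : 'Hom(F, P),
    forall x, g x = \sum_i act P ((x : {ffun _ -> _}) i) (e i).
  apply: linear_lfun => k x y; rewrite scaler_sumr -big_split.
  by apply: eq_bigr => i _; rewrite !ffunE act_l.
have eg : epi g.
  split=> [a x|].
    rewrite !gE linear_sum; apply: eq_bigr => i _.
    by rewrite ffunE actM.
  apply/eqP; rewrite eqEsubv subvf; apply/subvP=> x _; apply/memv_imgP.
  exists [ffun i => (coord (vbasis {:P}) i x)%:A]; rewrite ?memvf // gE.
  rewrite [LHS](coord_vbasis (memvf x)); apply: eq_bigr => i _.
  by rewrite ffunE -[_%:A]addr0 act_l act1 act_0l addr0.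
have [k hk /lfunP gk] := projP _ _ g _ eg (@is_hom_id _ _ _ P).
have /choice[c cE] : forall i, exists c : 'Hom(P, regular L s),
    forall x, c x = (k x : {ffun _ -> _}) i.
  by move=> i; apply: linear_lfun => t x y; rewrite linearP !ffunE.
have hc i : c i \in homs P.
  by apply/homsP => a x; rewrite !cE hk ffunE.
exists m, e, (fun i => vsproj (homs P) (c i)) => x.
have := gk x; rewrite id_lfunE comp_lfunE gE => {1}<-.
by apply: eq_bigr => i _; rewrite vsprojK // cE.
Qed.

(** The image of [phi] tensor [x] under Hom (P, L) tensor X -> Hom (P, X),
    which is bijective for projective P. *)
Definition tensor_hom P X (phi : hom_regular P) (x : X) : 'Hom(P, X) :=
  xget 0 [set g : 'Hom(P, X) | forall p, g p = act X (vsval phi p) x]%classic.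

Lemma tensor_homE P X (phi : hom_regular P) (x : X) p :
  tensor_hom phi x p = act X (vsval phi p) x.
Proof.
rewrite /tensor_hom; case: xgetP => [g _ -> // | no_g]; exfalso.
have [|g gE] := @linear_lfun _ P X (fun p => act X (vsval phi p) x); last exact: no_g gE.
by move=> k y z; rewrite linearP; apply: act_linear_l.
Qed.

Lemma tensor_hom_is_hom P X (phi : hom_regular P) (x : X) :
  is_hom (tensor_hom phi x).
Proof.
move=> a p; rewrite !tensor_homE.
by have /homsP -> := subvsP phi; rewrite actM.
Qed.

Lemma tensor_hom_linear P X (phi : hom_regular P) :
  linear (fun x : X => tensor_hom phi x).
Proof.
move=> k x y; apply/lfunP=> p.
by rewrite add_lfunE scale_lfunE !tensor_homE linearP.
Qed.

Lemma tensor_hom_linear_l P X (x : X) :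
  linear (fun phi : hom_regular P => tensor_hom phi x).
Proof.
move=> k f g; apply/lfunP=> p.
rewrite add_lfunE scale_lfunE !tensor_homE linearP add_lfunE scale_lfunE.
exact: act_linear_l.
Qed.

Lemma tensor_hom_act P X (phi : hom_regular P) (x : X) a :
  tensor_hom phi (act X a x) = tensor_hom (act (hom_regular P) a phi) x.
Proof.
by apply/lfunP=> p; rewrite !tensor_homE -actM homs_actE smul_opp.
Qed.

End DualBasis.

Section AuslanderReiten.
Variables (K : fieldType) (L : falgType K).
Implicit Types X P M T : rmodule L.

Definition precomp P1 P0 X (f : 'Hom(P1, P0)) : {vspace 'Hom(P1, X)} :=
  vspace_of (fun h => exists2 k : 'Hom(P0, X), is_hom k & h = (k \o f)%VF).

Lemma precompP P1 P0 X (f : 'Hom(P1, P0)) h :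
  h \in precomp X f <-> exists2 k : 'Hom(P0, X), is_hom k & h = (k \o f)%VF.
Proof.
apply: vspace_ofP.
  by exists 0; [apply: is_hom0 | rewrite comp_lfun0l].
move=> k _ _ [g hg ->] [h' hh' ->]; exists (k *: g + h').
  exact: is_hom_linear.
by rewrite comp_lfunDl comp_lfunZl.
Qed.

Lemma hdim_cokernel M P0 P1 X (f : 'Hom(P1, P0)) (p : 'Hom(P0, M)) :
  epi p -> limg f = lker p ->
  hdim P0 X = (hdim M X + \dim (precomp X f))%N.
Proof.
move=> ep fp.
apply: (dim_exact (comp_linear_l p) (comp_linear_l f)).
- move=> h _ /lfunP hp0; apply/lfunP=> y; have [x <-] := epi_surj y ep.
  by rewrite -comp_lfunE hp0 !zero_lfunE.
- move=> h /hom_spaceP hh; split.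
    by apply/hom_spaceP/is_hom_comp => //; case: ep.
  apply/lfunP=> x; rewrite !comp_lfunE zero_lfunE.
  have /eqP -> : p (f x) == 0 by rewrite -memv_ker -fp memv_img ?memvf.
  by rewrite linear0.
- move=> h /hom_spaceP hh hf0.
  have [|k hk <-] := epi_factor ep hh.
    rewrite -fp; apply/subvP=> _ /memv_imgP[x _ ->].
    by rewrite memv_ker -comp_lfunE hf0 zero_lfunE.
  by exists k; first apply/hom_spaceP.
- by move=> h /hom_spaceP hh; apply/precompP; exists h.
by move=> h /precompP[k hk ->]; exists k; first apply/hom_spaceP.
Qed.

(** Hom (X, D N) is dual to the cokernel of Hom (P0, X) -> Hom (P1, X) when N is
    the cokernel of Hom (P0, L) -> Hom (P1, L): both sides are the balanced
    bilinear forms on Hom (P1, L) x X which vanish on the image of Hom (P0, L),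
    since P1 and P0 are projective. The duality is exhibited by the pairing of u
    and h that sends h = tensor_hom phi x to [u x (q phi)], written in terms of
    a dual basis of P1. *)
Lemma hdim_dual_cokernel P0 P1 X (N : module L Left) (f : 'Hom(P1, P0))
    (q : 'Hom(hom_regular P1, N)) :
  projective P1 -> projective P0 -> is_hom f -> epi q ->
  (forall phi : hom_regular P1, q phi = 0 <->
     exists psi : hom_regular P0, vsval phi = (vsval psi \o f)%VF) ->
  (hdim X (dual N) + \dim (precomp X f) = hdim P1 X)%N.
Proof.
move=> proj1 proj0 hf eq_ kerq.
have [m [e [phi eK]]] := dual_basis proj1.
have [m' [e' [psi e'K]]] := dual_basis proj0.
have [hq _] := eq_.
have phiK (g : hom_regular P1) :
    \sum_i act (hom_regular P1) (vsval g (e i)) (phi i) = g.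
  apply/subvs_inj/lfunP=> p; rewrite linear_sum sum_lfunE.
  rewrite [in RHS](eK p) linear_sum; apply: eq_bigr => i _ /=.
  have /homsP -> := subvsP g.
  by rewrite homs_actE.
pose b (u : 'Hom(X, dual N)) (h : 'Hom(P1, X)) : K^o :=
  \sum_i (u (h (e i)) : 'Hom(N, K^o)) (q (phi i)).
have b_tensor u g x : is_hom u ->
    b u (tensor_hom g x) = (u x : 'Hom(N, K^o)) (q g).
  move=> hu; rewrite -[in RHS](phiK g) !linear_sum; apply: eq_bigr => i _.
  rewrite tensor_homE hu.
  transitivity ((u x : 'Hom(N, K^o)) (act N (vsval g (e i)) (q (phi i)))).
    by rewrite /= /dual_act comp_lfunE lfunE.
  by rewrite -[act N _ _]hq.
have bll h : linear (b^~ h).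
  move=> k u v; rewrite /b scaler_sumr -big_split; apply: eq_bigr => i _.
  by rewrite add_lfunE scale_lfunE add_lfunE scale_lfunE.
have blr u : linear (b u).
  move=> k h h'; rewrite /b scaler_sumr -big_split; apply: eq_bigr => i _.
  by rewrite add_lfunE scale_lfunE linearP add_lfunE scale_lfunE.
have tensor_sum P (projP : projective P) m0 (e0 : 'I_m0 -> P)
    (phi0 : 'I_m0 -> hom_regular P) (h : 'Hom(P, X)) :
    (forall x, x = \sum_i act P (vsval (phi0 i) x) (e0 i)) ->
    is_hom h -> h = \sum_i tensor_hom (phi0 i) (h (e0 i)).
  move=> eK0 hh; apply/lfunP=> p.
  rewrite sum_lfunE [in LHS](eK0 p) linear_sum /=.
  by apply: eq_bigr => i _; rewrite tensor_homE hh.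
apply: (dim_pairing bll blr).
- move=> u /hom_spaceP hu u0; apply/lfunP=> x; apply/lfunP=> n.
  have [g <-] := epi_surj n eq_; rewrite -b_tensor // zero_lfunE.
  by rewrite u0 ?zero_lfunE //; apply/hom_spaceP/tensor_hom_is_hom.
- move=> h /hom_spaceP hh; split.
    case/precompP=> k hk -> u /hom_spaceP hu.
    have [B BE] := linear_lfun (blr u).
    rewrite -BE (tensor_sum P0 proj0 _ e' psi k) //.
    have [C CE] := linear_lfun (@comp_linear_l _ _ _ X f).
    rewrite -CE !linear_sum /= big1 // => j _.
    have hpull : (vsval (psi j) \o f)%VF \in homs P1.
      apply/homsP/is_hom_comp => //; apply/homsP; exact: subvsP.
    have -> : C (tensor_hom (psi j) (k (e' j))) =
        tensor_hom (vsproj (homs P1) (vsval (psi j) \o f)%VF : hom_regular P1)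
          (k (e' j)).
      by rewrite CE; apply/lfunP=> x; rewrite comp_lfunE !tensor_homE vsprojK //
        comp_lfunE.
    rewrite BE b_tensor //.
    have -> : q (vsproj (homs P1) (vsval (psi j) \o f)%VF) = 0.
      by apply/kerq; exists (psi j); rewrite vsprojK.
    by rewrite linear0.
  (* A functional t which vanishes on the precompositions with f, but not at h,
     comes from the homomorphism u that sends x and q phi to
     t (tensor_hom phi x). *)
  move=> h0; apply: contrapT => /negP /separating_functional[t [th tR]].
  pose r := (q^-1)%VF.
  have rK n : q (r n) = n.
    by apply: limg_lfunVK; rewrite (proj2 eq_) memvf.
  have [u uE] : exists u : 'Hom(X, 'Hom(N, K^o)),
      forall x n, u x n = t (tensor_hom (r n) x).
    apply: bilinear_lfun => [x k n n' | n k x x'].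
      by rewrite linearP tensor_hom_linear_l linearP.
    by rewrite tensor_hom_linear linearP.
  have uq x g : u x (q g) = t (tensor_hom g x).
    rewrite uE; apply/eqP; rewrite -subr_eq0 -linearB /=; apply/eqP/tR.
    have [T TE] := linear_lfun (@tensor_hom_linear_l _ _ _ P1 X x).
    rewrite -!TE -linearB /= TE; apply/precompP.
    have /kerq[g' g'E] : q (r (q g) - g) = 0 by rewrite linearB /= rK subrr.
    exists (tensor_hom g' x); first exact: tensor_hom_is_hom.
    by apply/lfunP=> p; rewrite comp_lfunE !tensor_homE g'E comp_lfunE.
  apply: th; rewrite (tensor_sum P1 proj1 _ e phi h) // linear_sum /=.
  rewrite -[RHS](h0 (u : 'Hom(X, dual N))).
    by apply: eq_bigr => i _; rewrite -uq.
  apply/hom_spaceP => a x; apply/lfunP=> n; have [g <-] := epi_surj n eq_.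
  by rewrite /= /dual_act comp_lfunE lfunE /= -hq !uq tensor_hom_act.
apply/subvP=> _ /precompP[k hk ->].
by apply/hom_spaceP/is_hom_comp.
Qed.

(** The Auslander-Reiten formula, in the form dim Hom (M, X) - dim Hom (X, tau M)
    = dim Hom (P0, X) - dim Hom (P1, X). The two terms on the left are the dimensions
    of the kernel and the cokernel of Hom (P0, X) -> Hom (P1, X). *)
Lemma hdim_tau M T : is_tau M T ->
  exists P0 P1 : rmodule L, [/\ projective P0, projective P1 &
    forall X, (hdim M X + hdim P1 X = hdim P0 X + hdim X T)%N].
Proof.
case=> N [P1 [P0 [f [p [q [[[proj1 proj0 hf ep] [fp _ _]] eq_ kerq]]]]]] isoT.
exists P0, P1; split=> // X; rewrite (hdim_cokernel X ep fp) (hdim_isor X isoT).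
rewrite -(hdim_dual_cokernel X proj1 proj0 hf eq_ kerq) -addnA.
by rewrite [(\dim _ + _)%N]addnC.
Qed.

End AuslanderReiten.

(** * The top and the socle *)

Section TopSocle.
Variables (K : fieldType) (L : falgType K) (s : side).
Implicit Types M A B S : module L s.

Lemma vspace_minimal (V : vectType K) (P : {vspace V} -> Prop) :
  (exists U, P U) ->
  exists2 U, P U & forall W, P W -> (W <= U)%VS -> W = U.
Proof.
move=> [U0 PU0].
have ex_d : exists d, `[< exists2 U, P U & \dim U = d >].
  by exists (\dim U0); apply/asboolP; exists U0.
case: (ex_minnP ex_d) => d /asboolP[U PU dimU] min_d.
exists U => // W PW leWU; apply/eqP; rewrite eqEdim leWU dimU min_d //.
by apply/asboolP; exists W.
Qed.

Lemma vspace_maximal (V : vectType K) (P : {vspace V} -> Prop) :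
  (exists U, P U) ->
  exists2 U, P U & forall W, P W -> (U <= W)%VS -> W = U.
Proof.
move=> [U0 PU0].
have ex_d : exists d, `[< exists2 U, P U & \dim U = d >].
  by exists (\dim U0); apply/asboolP; exists U0.
have ub_d d : `[< exists2 U, P U & \dim U = d >] -> (d <= \dim {:V})%N.
  by move=> /asboolP[U _ <-]; rewrite dimvS ?subvf.
case: (ex_maxnP ex_d ub_d) => d /asboolP[U PU dimU] max_d.
exists U => // W PW leUW; apply/esym/eqP; rewrite eqEdim leUW dimU max_d //.
by apply/asboolP; exists W.
Qed.

Lemma simple_nonzero S : simple S -> nonzero S.
Proof. by case=> _ _ _ neq0 _ /esym. Qed.

Lemma simple_stable S (U : {vspace S}) :
  simple S -> stable U -> U = 0%VS \/ U = fullv.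
Proof. by case=> _ _ _ _ simS stU; apply: simS; rewrite ?sub0v ?subvf. Qed.

Lemma hom_from_simple S M (f : 'Hom(S, M)) :
  simple S -> is_hom f -> f = 0 \/ mono f.
Proof.
move=> simS hf; have [f0|f1] := simple_stable simS (stable_ker hf).
  by right.
left; apply/lfunP=> x; rewrite zero_lfunE; apply/eqP.
by rewrite -memv_ker f1 memvf.
Qed.

Lemma hom_to_simple S M (f : 'Hom(M, S)) :
  simple S -> is_hom f -> f = 0 \/ epi f.
Proof.
move=> simS hf.
have [f0|f1] := simple_stable simS (stable_img hf (@stablef _ _ _ M)).
  left; apply/lfunP=> x; rewrite zero_lfunE; apply/eqP.
  by rewrite -memv0 -f0 memv_img ?memvf.
by right.
Qed.

Lemma simple_img S M (f : 'Hom(S, M)) :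
  simple S -> mono f -> simple_factor 0%VS (limg f).
Proof.
move=> simS mf; have [hf _] := mf; split.
- exact: stable0.
- exact: stable_img (@stablef _ _ _ S).
- exact: sub0v.
- move=> f0; have /nonzero_vec[x] := simple_nonzero simS; apply.
  apply: (mono_inj mf); rewrite linear0; apply/eqP.
  by rewrite -memv0 f0 memv_img ?memvf.
move=> W stW _ leWf.
have fW : (f @: (f @^-1: W))%VS = W by apply: lpreimK.
have [W0|W1] := simple_stable simS (stable_preim hf stW).
  by left; rewrite -fW W0 limg0.
by right; rewrite -fW W1.
Qed.

Lemma simple_ker S M (f : 'Hom(M, S)) :
  simple S -> epi f -> simple_factor (lker f) fullv.
Proof.
move=> simS ef; have [hf fE] := ef; split.
- exact: stable_ker.
- exact: stablef.
- exact: subvf.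
- move=> f1; have /nonzero_vec[y] := simple_nonzero simS; apply.
  have [x <-] := epi_surj y ef.
  by apply/eqP; rewrite -memv_ker f1 memvf.
move=> W stW lefW _.
have in_W x y : y \in W -> f x = f y -> x \in W.
  move=> yW fxy; rewrite -[x](subrK y) memvD // (subvP lefW) //.
  by rewrite memv_ker linearB /= fxy subrr.
have [W0|W1] := simple_stable simS (stable_img hf stW).
  left; apply/eqP; rewrite eqEsubv lefW andbT; apply/subvP=> x xW.
  by rewrite memv_ker -memv0 -W0 memv_img.
right; apply/eqP; rewrite eqEsubv subvf; apply/subvP=> x _.
have : f x \in (f @: W)%VS by rewrite W1 memvf.
by case/memv_imgP=> y yW /(in_W _ _ yW).
Qed.

Lemma radical_stable M : stable (radical M).
Proof.
move=> a x /radicalP xrad; apply/radicalP => V maxV.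
by have [stV _ _ _ _] := maxV; apply: stV; apply: xrad.
Qed.

Lemma socle_stable M : stable (socle M).
Proof.
have [ge_soc le_soc] := socleP M.
pose P (x : M) := x \in socle M /\ forall a, act M a x \in socle M.
have PP : forall x, x \in vspace_of P <-> P x.
  apply: vspace_ofP; first by split=> [|a]; rewrite ?linear0 mem0v.
  move=> k x y [xs axs] [ys ays]; split=> [|a].
    by rewrite memvD ?memvZ.
  by rewrite linearP memvD ?memvZ ?axs ?ays.
have le_socP : (socle M <= vspace_of P)%VS.
  apply: le_soc => V simV; apply/subvP=> y yV; apply/PP.
  have [_ stV _ _ _] := simV.
  by split=> [|b]; apply: (subvP (ge_soc V simV)) => //; apply: stV.
by move=> a x /(subvP le_socP)/PP[_]; apply.
Qed.

Lemma hom_radical M S (f : 'Hom(M, S)) x :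
  simple S -> is_hom f -> x \in radical M -> f x = 0.
Proof.
move=> simS hf /radicalP xrad.
have [->|ef] := hom_to_simple simS hf; first by rewrite zero_lfunE.
by apply/eqP; rewrite -memv_ker xrad //; apply: simple_ker.
Qed.

Lemma hom_socle M S (f : 'Hom(S, M)) x :
  simple S -> is_hom f -> f x \in socle M.
Proof.
move=> simS hf.
have [->|mf] := hom_from_simple simS hf; first by rewrite zero_lfunE mem0v.
apply: (subvP ((socleP M).1 _ (simple_img simS mf))).
by rewrite memv_img ?memvf.
Qed.

(** Semisimplicity of M / rad M: a Z which is minimal with V + Z = M meets V
    inside every maximal submodule N, as otherwise Z could be replaced by its
    intersection with N. *)
Lemma top_complement M (V : {vspace M}) : stable V ->
  exists Z : {vspace M},
    [/\ stable Z, (V + Z = fullv)%VS & (V :&: Z <= radical M)%VS].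
Proof.
move=> stV.
have [|Z [stZ VZ] minZ] := @vspace_minimal _
    (fun Z : {vspace M} => stable Z /\ (V + Z = fullv)%VS).
  by exists fullv; split; [apply: stablef | rewrite addvf].
exists Z; split=> //; apply/subvP=> x xVZ; apply/radicalP=> N maxN.
have [stN _ _ neN simN] := maxN.
apply: contraT => xN.
have stVZ : stable (V :&: Z)%VS by apply: stable_cap.
have VZN : (V :&: Z + N = fullv)%VS.
  case: (simN (V :&: Z + N)%VS (stable_add stVZ stN) (addvSr _ _) (subvf _)) => //.
  by move=> eN; rewrite -eN (subvP (addvSl _ _)) in xN.
(* The modular law splits Z along N, so V + (N :&: Z) is still M. *)
have ZE : (V :&: Z + N :&: Z = Z)%VS.
  by rewrite vspace_modl ?capvSr // VZN capfv.
have ZN : (N :&: Z)%VS = Z.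
  apply: minZ (capvSr _ _); split; first exact: stable_cap.
  apply/eqP; rewrite eqEsubv subvf -VZ subv_add addvSl /= -{1}ZE.
  by rewrite subv_add addvSr (subv_trans (capvSl V Z) (addvSl _ _)).
by move: xVZ; rewrite memv_cap -ZN memv_cap (negPf xN) andbF.
Qed.

(** Semisimplicity of soc M: a simple submodule outside U + Z could be added to
    a Z which is maximal with intersection 0 with U. *)
Lemma socle_complement M (U : {vspace M}) : stable U ->
  exists Z : {vspace M},
    [/\ stable Z, (U :&: Z = 0)%VS & (socle M <= U + Z)%VS].
Proof.
move=> stU.
have [|Z [stZ UZ] maxZ] := @vspace_maximal _
    (fun Z : {vspace M} => stable Z /\ (U :&: Z = 0)%VS).
  by exists 0%VS; split; [apply: stable0 | rewrite capv0].
exists Z; split=> //; apply: (proj2 (socleP M)) => V simV.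
have [_ stV _ _ minV] := simV.
have stUZ : stable (U + Z)%VS by apply: stable_add.
have [V0|<-] := minV _ (stable_cap stV stUZ) (sub0v _) (capvSl _ _); last first.
  exact: capvSr.
suff <- : (Z + V)%VS = Z by rewrite addvA addvSr.
apply: maxZ (addvSl _ _); split; first exact: stable_add.
apply/eqP; rewrite -subv0; apply/subvP=> x; rewrite memv_cap.
case/andP=> xU /memv_addP[z zZ [v vV xE]].
have v0 : v = 0.
  apply/eqP; rewrite -memv0 -V0 memv_cap vV /=.
  have -> : v = x - z by rewrite xE addrAC subrr add0r.
  by rewrite memv_add ?memvN.
by rewrite -UZ memv_cap xU xE v0 addr0.
Qed.

Definition hom_killing M S (U : {vspace M}) : {vspace 'Hom(M, S)} :=
  vspace_of (fun h => is_hom h /\ forall x, x \in U -> h x = 0).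

Lemma hom_killingP M S (U : {vspace M}) (h : 'Hom(M, S)) :
  h \in hom_killing S U <-> is_hom h /\ forall x, x \in U -> h x = 0.
Proof.
apply: vspace_ofP.
  by split=> [|x _]; [apply: is_hom0 | rewrite zero_lfunE].
move=> k f g [hf f0] [hg g0]; split; first exact: is_hom_linear.
by move=> x xU; rewrite add_lfunE scale_lfunE f0 // g0 // scaler0 addr0.
Qed.

Definition hom_into S M (U : {vspace M}) : {vspace 'Hom(S, M)} :=
  vspace_of (fun h => is_hom h /\ forall x, h x \in U).

Lemma hom_intoP S M (U : {vspace M}) (h : 'Hom(S, M)) :
  h \in hom_into S U <-> is_hom h /\ forall x, h x \in U.
Proof.
apply: vspace_ofP.
  by split=> [|x]; [apply: is_hom0 | rewrite zero_lfunE mem0v].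
move=> k f g [hf fU] [hg gU]; split; first exact: is_hom_linear.
by move=> x; rewrite add_lfunE scale_lfunE memvD ?memvZ.
Qed.

Lemma id_linear (V : vectType K) : linear (@id V).
Proof. by []. Qed.

(** When V / U is isomorphic to S, the homomorphisms M -> S vanishing on U
    restrict to Hom (V / U, S), and all of the latter extend because V / U is a
    direct summand of the semisimple module M / U. *)
Lemma dim_hom_killing M S (U V : {vspace M}) :
  simple S -> simple_factor U V -> (radical M <= U)%VS ->
  \dim (hom_killing S U) =
    (\dim (hom_killing S V) + `[< factor_iso U V S >] * hdim S S)%N.
Proof.
move=> simS [stU stV leUV neUV simUV] leRU; case: asboolP; last first.
  move=> not_iso; rewrite mul0n addn0; congr (\dim _); apply/vspaceP=> h.
  apply/idP/idP => /hom_killingP[hh h0]; apply/hom_killingP; split=> // x xV.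
    apply: contrapT => hx; apply: not_iso; exists h; split.
    - by move=> a y _; apply: hh.
    - have [hV0|//] := simple_stable simS (stable_img hh stV).
      by case: hx; apply/eqP; rewrite -memv0 -hV0 memv_img.
    have stVk := stable_cap stV (stable_ker hh).
    case: (simUV _ stVk) => //; last 1 first.
    - move=> Vk; case: hx; apply/eqP; rewrite -memv_ker.
      by move: xV; rewrite -{1}Vk memv_cap => /andP[].
    - apply/subvP=> y yU; rewrite memv_cap memv_ker h0 // eqxx andbT.
      exact: (subvP leUV).
    exact: capvSl.
  by apply: h0; apply: (subvP leUV).
case=> f [hf fV kerf]; rewrite mul1n.
have [t tP] := section_on fV.
have fU x : x \in U -> f x = 0.
  by rewrite -kerf memv_cap memv_ker => /andP[_ /eqP].
have tf x : x \in V -> x - t (f x) \in U.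
  move=> xV; have [tV ft] := tP (f x).
  by rewrite -kerf memv_cap memvB // memv_ker linearB /= ft subrr.
have htf (h : 'Hom(M, S)) x : (forall y, y \in U -> h y = 0) -> x \in V ->
    h (t (f x)) = h x.
  move=> h0 xV; apply/esym/eqP; rewrite -subr_eq0 -linearB /=.
  by rewrite h0 ?tf.
apply: (dim_exact (@id_linear _) (@comp_linear_l _ _ _ S t)).
- by [].
- move=> h /hom_killingP[hh h0]; split.
    by apply/hom_killingP; split=> // x xU; apply: h0; apply: (subvP leUV).
  by apply/lfunP=> y; rewrite comp_lfunE h0 ?zero_lfunE //; case: (tP y).
- move=> h /hom_killingP[hh h0] /lfunP ht; exists h => //.
  apply/hom_killingP; split=> // x xV.
  by rewrite -(htf h x h0 xV) -comp_lfunE ht zero_lfunE.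
- move=> h /hom_killingP[hh h0]; apply/hom_spaceP => a y; rewrite !comp_lfunE.
  have [tV ft] := tP y.
  by rewrite -{1}ft -hf // htf // ?hh //; apply: stV.
move=> e /hom_spaceP he.
(* The sum V + Z = M need not be direct, but V :&: Z lies in rad M <= U, where
   f vanishes: so f composed with the linear projection p1 on V is a homomorphism
   on M which extends f, and e is lifted through it. *)
have [Z [stZ VZ VZrad]] := top_complement stV.
pose p1 := addv_pi1 V Z; pose p2 := addv_pi2 V Z.
have pE x : p1 x + p2 x = x by rewrite addv_pi1_pi2 ?VZ ?memvf.
have fp1 x v z : v \in V -> z \in Z -> x = v + z -> f (p1 x) = f v.
  move=> vV zZ xE; apply/eqP; rewrite -subr_eq0 -linearB /=; apply/eqP/fU.
  apply: (subvP leRU); apply: (subvP VZrad); rewrite memv_cap.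
  rewrite memvB ?memv_pi1 //=.
  have -> : p1 x - v = z - p2 x.
    by apply/eqP; rewrite subr_eq addrAC -[_ == _]eq_sym subr_eq pE xE addrC.
  by rewrite memvB ?memv_pi2.
have fpV x : x \in V -> f (p1 x) = f x.
  by move=> xV; apply: (fp1 x x 0); rewrite ?mem0v ?addr0.
exists (e \o f \o p1)%VF; last first.
  apply/lfunP=> y; rewrite !comp_lfunE; have [tV ft] := tP y.
  by rewrite fpV // ft.
apply/hom_killingP; split=> [a x | x xU]; last first.
  by rewrite !comp_lfunE fpV ?(subvP leUV) // fU ?linear0.
rewrite !comp_lfunE -he -hf ?memv_pi1 //; congr (e _).
apply: (fp1 _ (act M a (p1 x)) (act M a (p2 x))).
- by apply: stV; apply: memv_pi1.
- by apply: stZ; apply: memv_pi2.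
by rewrite -linearD pE.
Qed.

(** Dually, all of Hom (S, V / U) lifts to V since U is a direct summand of the
    semisimple module V. *)
Lemma dim_hom_into M S (U V : {vspace M}) :
  simple S -> simple_factor U V -> (V <= socle M)%VS ->
  \dim (hom_into S V) =
    (\dim (hom_into S U) + `[< factor_iso U V S >] * hdim S S)%N.
Proof.
move=> simS [stU stV leUV neUV simUV] leVS; case: asboolP; last first.
  move=> not_iso; rewrite mul0n addn0; congr (\dim _); apply/vspaceP=> h.
  apply/idP/idP => /hom_intoP[hh hV]; apply/hom_intoP; split=> // x; last first.
    exact: (subvP leUV).
  apply: contrapT => hx; apply: not_iso.
  have stUh := stable_preim hh stU.
  have {stUh} [U0|U1] := simple_stable simS stUh; last first.
    by case: hx; rewrite memv_preim U1 memvf.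
  have cap0 : (U :&: limg h = 0)%VS.
    apply/eqP; rewrite -subv0; apply/subvP=> z /memv_capP[zU /memv_imgP[y _ zE]].
    have /eqP y0 : y == 0 by rewrite -memv0 -U0 -memv_preim -zE.
    by rewrite zE y0 linear0 mem0v.
  have kerh y : h y = 0 -> y = 0.
    by move=> hy; apply/eqP; rewrite -memv0 -U0 -memv_preim hy mem0v.
  have hK : cancel h h^-1%VF.
    by apply: lker0_lfunK; rewrite -subv0; apply/subvP=> y; rewrite memv_ker
      memv0 => /eqP/kerh ->.
  have stI := stable_img hh (@stablef _ _ _ S).
  have VE : (U + limg h)%VS = V.
    case: (simUV _ (stable_add stU stI)) => //.
    - exact: addvSl.
    - rewrite subv_add leUV; apply/subvP=> _ /memv_imgP[y _ ->]; exact: hV.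
    by move=> UE; case: hx; rewrite -UE (subvP (addvSr _ _)) // memv_img ?memvf.
  (* V is the direct sum of U and a copy h (S) of S: the isomorphism from V / U
     to S is the projection on h (S) followed by the inverse of h. *)
  pose p := addv_pi2 U (limg h).
  have pE v : v \in V -> exists u y, [/\ u \in U, v = u + h y & p v = h y].
    move=> vV; exists (addv_pi1 U (limg h) v).
    have /memv_imgP[y _ pv] := memv_pi2 U (limg h) v.
    exists y; split=> //; first exact: memv_pi1.
    by rewrite -pv addv_pi1_pi2 ?VE.
  have pI u y : u \in U -> p (u + h y) = h y.
    move=> uU; have [|u' [y' [u'U E ->]]] := pE (u + h y).
      by rewrite -VE memv_add // memv_img ?memvf.
    have : h y' - h y \in (U :&: limg h)%VS.
      rewrite memv_cap; apply/andP; split; last by rewrite memvB ?memv_img ?memvf.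
      have -> : h y' - h y = u - u'.
        apply/eqP; rewrite subr_eq addrAC -[_ == _]eq_sym subr_eq E.
        by rewrite addrC.
      by rewrite memvB.
    by rewrite cap0 memv0 subr_eq0 => /eqP.
  exists (h^-1 \o p)%VF; split.
  - move=> a v /pE[u [y [uU -> pv]]].
    by rewrite !comp_lfunE [act M a _]linearD /= -hh !pI ?hK //; apply: stU.
  - apply/eqP; rewrite eqEsubv subvf; apply/subvP=> y _; apply/memv_imgP.
    by exists (h y) => //; rewrite comp_lfunE -[h y]add0r pI ?mem0v ?hK.
  apply/vspaceP=> v; rewrite memv_cap memv_ker; apply/andP/idP => [[]|vU].
    move=> /pE[u [y [uU -> pv]]]; rewrite comp_lfunE pv hK => /eqP ->.
    by rewrite linear0 addr0.
  split; first exact: (subvP leUV).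
  by rewrite comp_lfunE -[v]addr0 -[in X in v + X](linear0 h) pI // hK.
case=> f [hf fV kerf]; rewrite mul1n.
have [t tP] := section_on fV.
have fU x : x \in U -> f x = 0.
  by rewrite -kerf memv_cap memv_ker => /andP[_ /eqP].
apply: (dim_exact (@id_linear _) (@comp_linear_r _ S _ _ f)).
- by [].
- move=> h /hom_intoP[hh hU]; split.
    by apply/hom_intoP; split=> // x; apply: (subvP leUV).
  by apply/lfunP=> x; rewrite comp_lfunE fU ?zero_lfunE.
- move=> h /hom_intoP[hh hV] /lfunP fh0; exists h => //.
  apply/hom_intoP; split=> // x; rewrite -kerf memv_cap hV memv_ker /=.
  by rewrite -comp_lfunE fh0 zero_lfunE.
- move=> h /hom_intoP[hh hV]; apply/hom_spaceP => a x.
  by rewrite !comp_lfunE hh hf.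
move=> e /hom_spaceP he.
(* A linear section t of f : V -> S becomes a homomorphism when it is corrected
   by its component in U, so as to take its values in V :&: Z, on which f is
   injective. *)
have [Z [stZ UZ leUZ]] := socle_complement stU.
pose j := (addv_pi2 U Z \o t)%VF.
have jP y : [/\ j y \in V, j y \in Z & f (j y) = y].
  have [tV ft] := tP y; rewrite /j comp_lfunE.
  have tE : addv_pi1 U Z (t y) + addv_pi2 U Z (t y) = t y.
    by rewrite addv_pi1_pi2 // (subvP leUZ) // (subvP leVS).
  have pE : addv_pi2 U Z (t y) = t y - addv_pi1 U Z (t y).
    by rewrite -[in X in X - _]tE addrAC subrr add0r.
  split; first by rewrite pE memvB // (subvP leUV) ?memv_pi1.
    exact: memv_pi2.
  by rewrite pE linearB /= ft fU ?subr0 ?memv_pi1.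
have hj : is_hom j.
  move=> a y; apply/eqP; rewrite -subr_eq0 -memv0 -UZ memv_cap.
  have [jyV jyZ fj] := jP y; have [jaV jaZ fja] := jP (act S a y).
  rewrite -{1}kerf !memv_cap memv_ker linearB /= hf // fj fja subrr eqxx andbT.
  by rewrite (memvB jaV (stV a _ jyV)) (memvB jaZ (stZ a _ jyZ)).
exists (j \o e)%VF; last first.
  apply/lfunP=> y; rewrite comp_lfunE [(j \o e)%VF y]comp_lfunE.
  by case: (jP (e y)).
apply/hom_intoP; split=> [|x]; first exact: is_hom_comp.
by rewrite comp_lfunE; case: (jP (e x)).
Qed.

Definition factor_count M S (U : {vspace M}) (c : seq {vspace M}) : nat :=
  count (fun W => `[< factor_iso W.1 W.2 S >]) (zip (U :: c) c).

Lemma top_count M S (c : seq {vspace M}) : simple S ->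
  composition_series (radical M) fullv c ->
  (factor_count S (radical M) c * hdim S S)%N = hdim M S.
Proof.
move=> simS [pathc lastc].
have -> : hdim M S = \dim (hom_killing S (radical M)).
  congr (\dim _); apply/vspaceP=> h; apply/idP/idP.
    move=> /hom_spaceP hh; apply/hom_killingP; split=> // x.
    exact: hom_radical.
  by move=> /hom_killingP[hh _]; apply/hom_spaceP.
suff count_killing (U : {vspace M}) :
    path (fun W W' => `[< simple_factor W W' >]) U c -> last U c = fullv ->
    (radical M <= U)%VS ->
    (factor_count S U c * hdim S S)%N = \dim (hom_killing S U).
  exact: count_killing.
elim: c {pathc lastc} U => [|V c IHc] U /=.
  move=> _ -> _; rewrite mul0n; apply/esym/eqP; rewrite dimv_eq0 -subv0.
  apply/subvP=> h /hom_killingP[_ h0]; rewrite memv0; apply/eqP/lfunP=> x.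
  by rewrite zero_lfunE h0 ?memvf.
case/andP=> /asboolP simUV pathc lastc leU.
rewrite (dim_hom_killing simS simUV leU) -(IHc V pathc lastc); last first.
  by apply: subv_trans leU _; case: simUV.
by rewrite /factor_count /= mulnDl addnC.
Qed.

Lemma socle_count M S (c : seq {vspace M}) : simple S ->
  composition_series 0%VS (socle M) c ->
  (factor_count S 0%VS c * hdim S S)%N = hdim S M.
Proof.
move=> simS [pathc lastc].
have -> : hdim S M = \dim (hom_into S (socle M)).
  congr (\dim _); apply/vspaceP=> h; apply/idP/idP.
    move=> /hom_spaceP hh; apply/hom_intoP; split=> // x.
    exact: hom_socle.
  by move=> /hom_intoP[hh _]; apply/hom_spaceP.
have into0 : \dim (hom_into S (0%VS : {vspace M})) = 0%N.
  apply/eqP; rewrite dimv_eq0 -subv0; apply/subvP=> h /hom_intoP[_ h0].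
  rewrite memv0; apply/eqP/lfunP=> x; rewrite zero_lfunE; apply/eqP.
  by rewrite -memv0 h0.
suff count_into (U : {vspace M}) :
    path (fun W W' => `[< simple_factor W W' >]) U c -> last U c = socle M ->
    \dim (hom_into S (socle M)) =
      (factor_count S U c * hdim S S + \dim (hom_into S U))%N /\
    (U <= socle M)%VS.
  by have [-> _] := count_into _ pathc lastc; rewrite into0 addn0.
elim: c {pathc lastc} U => [|V c IHc] U /=; first by move=> _ ->.
case/andP=> /asboolP simUV pathc lastc.
have [-> leV] := IHc V pathc lastc; split; last first.
  by apply: subv_trans leV; case: simUV.
rewrite (dim_hom_into simS simUV leV) /factor_count /= mulnDl.
by rewrite addnA addnAC [X in (X + _)%N]addnC.
Qed.

End TopSocle.

(** * The Euler form of a balanced pair *)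

Section EulerForm.
Variables (K : fieldType) (L : falgType K).
Implicit Types (p q : mpair L) (X M N Q T : rmodule L).

Definition euler p X : int := (hdim p.1 X)%:Z - (hdim X p.2)%:Z.

Lemma euler_pair_iso p q X : pair_iso p q -> euler p X = euler q X.
Proof.
by case=> iso1 iso2; rewrite /euler (hdim_isol X iso1) (hdim_isor X iso2).
Qed.

(** By the Auslander-Reiten formula the Euler form of (A, tau A + I) is
    dim Hom (P0, -) - dim Hom (P1, -) - dim Hom (-, I) with P0 and P1 projective,
    and each of the three terms is additive. *)
Lemma euler_additive p N M Q (f : 'Hom(N, M)) (g : 'Hom(M, Q)) :
  balanced p -> short_exact f g -> euler p M = euler p N + euler p Q.
Proof.
case=> _ [T [I [tauT injI isoB]]] _ fg.
have [P0 [P1 [proj0 proj1 ar]]] := hdim_tau tauT.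
have eulerE X : euler p X = (hdim P0 X)%:Z - (hdim P1 X)%:Z - (hdim X I)%:Z.
  by rewrite /euler (hdim_isor X isoB) hdim_dsum; have := ar X; lia.
rewrite !eulerE (hdim_projective proj0 fg) (hdim_projective proj1 fg).
by rewrite (hdim_injective injI fg); lia.
Qed.

Lemma image_factorization M N (f : 'Hom(M, N)) : is_hom f ->
  exists (I : rmodule L) (k : 'Hom(M, I)) (i : 'Hom(I, N)),
    [/\ epi k, mono i & (i \o k)%VF = f].
Proof.
move=> hf.
have [I [i [mi iE]]] := submodule_exists (stable_img hf (@stablef _ _ _ M)).
have [|k hk ik] := mono_factor mi hf; first by rewrite iE.
exists I, k, i; split=> //; split=> //.
apply/eqP; rewrite eqEsubv subvf; apply/subvP=> y _.
have : i y \in limg f by rewrite -iE memv_img ?memvf.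
case/memv_imgP=> x _; rewrite -ik comp_lfunE => /(mono_inj mi) ->.
by rewrite memv_img ?memvf.
Qed.

Section Representatives.
Variables (n : nat) (S : 'I_n -> rmodule L).
Hypothesis simplesS : simple_representatives S.

(** Multiplicities in top and socle are read off the Hom spaces with the simple
    modules. *)
Lemma gvec_euler p k :
  gvec S p ord0 k * (hdim (S k) (S k))%:Z = euler p (S k).
Proof.
have [simS _ _] := simplesS.
rewrite /gvec /dimv_factor !mxE /euler mulrBl -!PoszM.
congr (Posz _ - Posz _).
  case: xgetP => [c _ serc | no_c]; first exact: (top_count (simS k)).
  have [c /no_c] // := composition_series_exists (@radical_stable _ _ _ p.1)
    (@stablef _ _ _ p.1) (subvf _).
case: xgetP => [c _ serc | no_c]; first exact: (socle_count (simS k)).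
have [c /no_c] // := composition_series_exists (@stable0 _ _ _ p.2)
  (@socle_stable _ _ _ p.2) (sub0v _).
Qed.

Lemma simple_submodule_exists X : nonzero X ->
  exists2 U : {vspace X}, stable U & simple_factor 0%VS U.
Proof.
move=> nzX; have [|U [stU U0] minU] := @vspace_minimal _ _
    (fun U : {vspace X} => stable U /\ U <> 0%VS).
  by exists fullv; split; [apply: stablef | ].
exists U => //; split=> //; first exact: stable0.
- exact: sub0v.
- by move/esym.
move=> W stW _ leWU; have [->|W0] := pselect (W = 0%VS); first by left.
by right; apply: minU.
Qed.

Lemma simple_of_submodule X T (i : 'Hom(T, X)) (U : {vspace X}) :
  mono i -> limg i = U -> simple_factor 0%VS U -> simple T.
Proof.
move=> mi iE [_ stU _ neU simU]; have [hi ki] := mi.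
split; [exact: stable0 | exact: stablef | exact: sub0v | | ].
  by move=> T0; apply: neU; rewrite -iE -T0 limg0.
move=> W stW _ _.
have k0 : lker i == 0%VS by apply/eqP.
case: (simU (i @: W)%VS (stable_img hi stW)); rewrite ?sub0v -?iE ?limgS ?subvf //.
  by move/eqP; rewrite -(limg0 i) (eq_limg_ker0 _ _ k0) => /eqP ->; left.
by move/eqP; rewrite (eq_limg_ker0 _ _ k0) => /eqP ->; right.
Qed.

(** One vector [c] serves all balanced pairs, because their Euler forms are all
    additive along the same composition series of X. *)
Lemma euler_multiplicities X : exists2 c : 'I_n -> nat,
  nonzero X -> exists k, (0 < c k)%N &
  forall p, balanced p -> euler p X = \sum_k (c k)%:Z * euler p (S k).
Proof.
have [_ _ repS] := simplesS.
have [m] := ubnP (\dim {:X}); elim: m X => // m IHm X lt_m.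
have [X0 | nzX] := pselect (nonzero X -> False).
  exists (fun=> 0%N) => [/X0 //|p _]; rewrite big1; last first.
    by move=> k _; rewrite mul0r.
  have x0 (x : X) : x = 0.
    by apply: contrapT => x0; apply/X0/nonzero_vec; exists x.
  have /hdim_eq0 h1 : hom_zero p.1 X.
    by move=> f _; apply/lfunP=> x; rewrite zero_lfunE (x0 (f x)).
  have /hdim_eq0 h2 : hom_zero X p.2.
    by move=> f _; apply/lfunP=> x; rewrite zero_lfunE (x0 x) linear0.
  by rewrite /euler h1 h2.
have {}nzX : nonzero X by apply: contrapT.
have [U stU simU] := simple_submodule_exists nzX.
have [T [Q [i [g [ig iE]]]]] := short_exact_of_stable stU.
have [mi eg kerg] := ig.
have [k isoT] := repS T (simple_of_submodule mi iE simU).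
have [|c _ cE] := IHm Q.
  rewrite -ltnS; apply: leq_trans lt_m; rewrite ltnS.
  rewrite -(limg_ker_dim g {:X}) capfv (proj2 eg) -kerg iE -addn1 addnC leq_add2r.
  rewrite lt0n dimv_eq0; apply/eqP => U0.
  by have [_ _ _] := simU; rewrite U0.
exists (fun j => (c j + (j == k))%N) => [_|p balp].
  by exists k; rewrite eqxx addn1.
rewrite (euler_additive balp ig) cE // addrC.
under [RHS]eq_bigr => j _ do rewrite PoszD mulrDl.
rewrite big_split /=; congr (_ + _).
rewrite (bigD1 k) //= eqxx mul1r big1 ?addr0; last first.
  by move=> j /negPf ->; rewrite mul0r.
by rewrite /euler (hdim_isol p.2 isoT) (hdim_isor p.1 isoT).
Qed.

Lemma euler_gvec (R : realType) X : exists2 w : 'I_n -> R,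
  (forall k, 0 <= w k) /\ (nonzero X -> exists k, 0 < w k) &
  forall p, balanced p ->
    (euler p X)%:~R = \sum_k w k * real_vec R (gvec S p) ord0 k.
Proof.
have [simS _ _] := simplesS.
have [c c_gt0 cE] := euler_multiplicities X.
exists (fun k => (c k * hdim (S k) (S k))%N%:R); first split=> [k|nzX].
- exact: ler0n.
- have [k ck] := c_gt0 nzX; exists k.
  by rewrite ltr0n muln_gt0 ck hdim_gt0 //; apply: simple_nonzero.
move=> p balp; rewrite cE // rmorph_sum; apply: eq_bigr => k _.
rewrite -gvec_euler [real_vec _ _ _ _]mxE; move: (gvec S p ord0 k) => z.
by rewrite !rmorphM /= -!pmulrn; ring.
Qed.

(** The linear form that computes the Euler forms at X is applied to the
    relation; [t] is its value at eta, which is positive since X has a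
    composition factor. *)
Lemma euler_relation (R : realType) X p (q : 'I_n -> mpair L)
    (r : 'I_n -> R) (d : R) :
  nonzero X -> balanced p -> (forall j, balanced (q j)) ->
  real_vec R (gvec S p) + d *: Defs.eta R n =
    \sum_j r j *: real_vec R (gvec S (q j)) ->
  exists2 t : R, 0 < t &
    (euler p X)%:~R + d * t = \sum_j r j * (euler (q j) X)%:~R.
Proof.
move=> nzX balp balq vE; have [w [w_ge0 w_gt0] wE] := euler_gvec R X.
exists (\sum_k w k).
  have [k wk] := w_gt0 nzX; rewrite (bigD1 k) //=.
  by rewrite ltr_pwDl // sumr_ge0.
rewrite wE // mulr_sumr -big_split.
under [RHS]eq_bigr => j _ do rewrite wE // mulr_sumr.
rewrite exchange_big; apply: eq_bigr => k _ /=.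
have /rowP/(_ k) := vE; rewrite summxE.
have -> (v : 'rV[R]_n) : (v + d *: Defs.eta R n) ord0 k = v ord0 k + d * 1.
  by rewrite !mxE.
move=> vk; transitivity (w k * (real_vec R (gvec S p) ord0 k + d * 1)).
  by ring.
rewrite vk mulr_sumr; apply: eq_bigr => j _.
have -> (a : R) (v : 'rV[R]_n) : (a *: v) ord0 k = a * v ord0 k by rewrite mxE.
by ring.
Qed.

End Representatives.
End EulerForm.

(** * Covering and flooring walls *)

Section Walls.
Variables (K : fieldType) (L : falgType K).
Implicit Types (p : mpair L) (X M N Q : rmodule L).

Lemma hom_zero_dsuml M N X :
  hom_zero (dsum M N) X <-> hom_zero M X /\ hom_zero N X.
Proof.
rewrite -!hdim_eq0 hdim_dsuml.
by split=> [/eqP | [-> ->]] //; rewrite addn_eq0 => /andP[/eqP -> /eqP ->].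
Qed.

Lemma hom_zero_dsumr M N X :
  hom_zero X (dsum M N) <-> hom_zero X M /\ hom_zero X N.
Proof.
rewrite -!hdim_eq0 hdim_dsum.
by split=> [/eqP | [-> ->]] //; rewrite addn_eq0 => /andP[/eqP -> /eqP ->].
Qed.

Lemma hom_zero_from0 X : hom_zero (zero_module L Right) X.
Proof.
move=> f _; apply/lfunP=> x; have -> : x = 0 by apply: thinmx0.
by rewrite linear0 zero_lfunE.
Qed.

Lemma hom_zero_to0 X : hom_zero X (zero_module L Right).
Proof.
by move=> f _; apply/lfunP=> x; rewrite zero_lfunE; apply: thinmx0.
Qed.

Lemma big_pairP (I : finType) (P : pred I) (q : I -> mpair L)
    (good : mpair L -> Prop) :
  good (Defs.pair_zero L) ->
  (forall p1 p2, good (pair_sum p1 p2) <-> good p1 /\ good p2) ->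
  good (\big[@pair_sum K L/Defs.pair_zero L]_(i | P i) q i) <->
  (forall i, P i -> good (q i)).
Proof.
move=> good0 goodD; split=> [|goodq]; last first.
  elim/big_ind: _ => // p1 p2 g1 g2; exact/goodD.
move=> goodq i Pi; move: goodq (mem_index_enum i).
elim: (index_enum I) => // j r IHr; rewrite big_cons in_cons.
case: ifP => [Pj /goodD[gj gr] | Pj gr] /predU1P[ij | ir].
- by rewrite ij.
- exact: IHr.
- by rewrite ij Pj in Pi.
- exact: IHr.
Qed.

Lemma hom_zero_from_big (I : finType) (P : pred I) (q : I -> mpair L) X :
  hom_zero (\big[@pair_sum K L/Defs.pair_zero L]_(i | P i) q i).1 X <->
  (forall i, P i -> hom_zero (q i).1 X).
Proof.
apply: (big_pairP P q (good := fun p => hom_zero p.1 X)).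
  exact: hom_zero_from0.
by move=> p1 p2; apply: hom_zero_dsuml.
Qed.

Lemma hom_zero_to_big (I : finType) (P : pred I) (q : I -> mpair L) X :
  hom_zero X (\big[@pair_sum K L/Defs.pair_zero L]_(i | P i) q i).2 <->
  (forall i, P i -> hom_zero X (q i).2).
Proof.
apply: (big_pairP P q (good := fun p => hom_zero X p.2)).
  exact: hom_zero_to0.
by move=> p1 p2; apply: hom_zero_dsumr.
Qed.

Lemma hom_zero_sub X M N (i : 'Hom(M, N)) :
  mono i -> hom_zero X N -> hom_zero X M.
Proof.
move=> mi /hdim_eq0 h; apply/hdim_eq0/eqP.
by have := hdim_mono_le X mi; rewrite h leqn0.
Qed.

Lemma hom_zero_quotient X M N (k : 'Hom(M, N)) :
  epi k -> hom_zero M X -> hom_zero N X.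
Proof.
move=> ek /hdim_eq0 h; apply/hdim_eq0/eqP.
by have := hdim_epi_le X ek; rewrite h leqn0.
Qed.

Lemma euler_ge0 p X : hom_zero X p.2 -> 0 <= euler p X.
Proof. by move=> /hdim_eq0 h; rewrite /euler h; lia. Qed.

Lemma euler_le0 p X : hom_zero p.1 X -> euler p X <= 0.
Proof. by move=> /hdim_eq0 h; rewrite /euler h; lia. Qed.

Lemma euler_jasso p X : jasso p X -> euler p X = 0.
Proof. by case=> /hdim_eq0 h1 /hdim_eq0 h2; rewrite /euler h1 h2. Qed.

Section Complete.
Variables (n : nat) (q : 'I_n -> mpair L).
Hypothesis complete_q : complete_balanced q.

Lemma complete_hom_zero i j : hom_zero (q i).1 (q j).2.
Proof.
have [[h _ _] _ _] := complete_q.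
have /hom_zero_from_big/(_ i isT) h' := h.
by move/hom_zero_to_big: h'; apply.
Qed.

Lemma complete_is_balanced i : balanced (q i).
Proof. by have [_ /(_ i)[]] := complete_q. Qed.

Variable i : 'I_n.
Let others := \big[@pair_sum K L/Defs.pair_zero L]_(j | j != i) q j.

Lemma jassoP X : jasso others X <->
  forall j, j != i -> jasso (q j) X.
Proof.
split=> [[/hom_zero_from_big h1 /hom_zero_to_big h2] j ji | h].
  by split; [apply: h1 | apply: h2].
by split; [apply/hom_zero_from_big | apply/hom_zero_to_big] => j /h[].
Qed.

(** A simple object M of the Jasso category is a quotient of the opposite
    component A of the pair as soon as Hom (A, M) is nonzero: the image of A in M
    stays in the category, since Hom (A, B) = 0 for all the components B. *)
Lemma jasso_simple_quotient M :
  simple_object (jasso others) M -> ~ hom_zero (q i).1 M ->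
  quotient_of M (q i).1.
Proof.
case=> [JM _ simM] /not_hom_zero[f hf f0].
have [I [k [m [ek mm mk]]]] := image_factorization hf.
have JI : jasso others I.
  apply/jassoP=> j ji; have [h1 _] := (jassoP M).1 JM j ji; split.
    exact: hom_zero_sub mm h1.
  exact: hom_zero_quotient ek (@complete_hom_zero i j).
case: (simM I m JI (proj1 mm)) => [Z g h _ _ _ /lfunP gh | I0 | [_ em]].
- by apply/lfunP=> x; apply: (mono_inj mm); rewrite -!comp_lfunE gh.
- case: f0; rewrite -mk; apply/lfunP=> x; rewrite comp_lfunE zero_lfunE.
  have -> : k x = 0.
    by apply: contrapT => kx; apply: I0; apply/nonzero_vec; exists (k x).
  by rewrite linear0.
by exists f; rewrite -mk; apply: epi_comp.
Qed.

(** Dually, if Hom (M, B) is nonzero, then M embeds in B. Here the subobject to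
    be excluded is the kernel N of M -> B; as its image I and M have Euler forms
    0 for the pairs other than [q i], so has N, and then Hom (A, N) = 0 forces
    Hom (N, B) = 0 for their components A and B. *)
Lemma jasso_simple_submodule M :
  simple_object (jasso others) M -> ~ hom_zero M (q i).2 ->
  submodule_of M (q i).2.
Proof.
case=> [JM _ simM] /not_hom_zero[f hf f0].
have [I [k [m [ek mm mk]]]] := image_factorization hf.
have hk := proj1 ek.
have [N [l [ml lE]]] := submodule_exists (stable_ker hk).
have JI j : j != i -> jasso (q j) I.
  move=> ji; have [_ h2] := (jassoP M).1 JM j ji; split.
    exact: hom_zero_sub mm (@complete_hom_zero j i).
  exact: hom_zero_quotient ek h2.
have JN : jasso others N.
  apply/jassoP=> j ji; have JMj := (jassoP M).1 JM j ji.
  have h1 : hom_zero (q j).1 N := hom_zero_sub ml (proj1 JMj).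
  split=> //; apply/hdim_eq0.
  have := euler_additive (complete_is_balanced j) (And3 ml ek lE).
  rewrite (euler_jasso JMj) (euler_jasso (JI j ji)) /euler.
  by have /hdim_eq0 -> := h1; lia.
case: (simM N l JN (proj1 ml)) => [Z g h _ _ _ /lfunP gh | N0 | [_ [_ el]]].
- by apply/lfunP=> x; apply: (mono_inj ml); rewrite -!comp_lfunE gh.
- exists f; rewrite -mk; apply: mono_comp => //; split=> //.
  rewrite -lE; apply/eqP; rewrite -subv0; apply/subvP=> _ /memv_imgP[x _ ->].
  have -> : x = 0.
    by apply: contrapT => x0; apply: N0; apply/nonzero_vec; exists x.
  by rewrite linear0 mem0v.
case: f0; rewrite -mk; apply/lfunP=> x; rewrite comp_lfunE zero_lfunE.
have /eqP -> : k x == 0 by rewrite -memv_ker -lE el memvf.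
by rewrite linear0.
Qed.

End Complete.

Section Relation.
Variables (R : realType) (n : nat) (S : 'I_n -> rmodule L).
Hypothesis simplesS : simple_representatives S.
Variables (p : mpair L) (q : 'I_n -> mpair L) (i : 'I_n).
Hypothesis balanced_p : balanced p.
Hypothesis complete_q : complete_balanced q.
Hypothesis iso_qp : pair_iso (q i) p.
Variables (r : 'I_n -> R) (e : R).
Hypotheses (r_gt0 : forall j, 0 < r j) (e_gt0 : 0 < e).

Let a X j : R := (euler (q j) X)%:~R.

Lemma relation_split d X : nonzero X ->
  real_vec R (gvec S p) + d *: Defs.eta R n =
    \sum_j r j *: real_vec R (gvec S (q j)) ->
  exists2 t : R, 0 < t &
    a X i + d * t = r i * a X i + \sum_(j | j != i) r j * a X j.
Proof.
move=> nzX vE; have balq j := complete_is_balanced complete_q j.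
have [t t_gt0 tE] := euler_relation simplesS nzX balanced_p balq vE.
exists t => //; rewrite /a (euler_pair_iso X iso_qp) tE (bigD1 i) //=.
by rewrite (euler_pair_iso X iso_qp).
Qed.

Let others := \big[@pair_sum K L/Defs.pair_zero L]_(j | j != i) q j.

Lemma others_sum0 M : jasso others M -> \sum_(j | j != i) r j * a M j = 0.
Proof.
move=> /jassoP JM; rewrite big1 // => j ji.
by rewrite /a (euler_jasso (JM j ji)) mulr0.
Qed.

(** If Hom (A_i, M) = 0, the relation at M makes the coefficient of [q i] exceed
    1, whereas evaluating it at A_i itself, where all the Euler forms are
    nonnegative, makes that coefficient less than 1. *)
Lemma hom_nonzero_above M :
  real_vec R (gvec S p) - e *: Defs.eta R n =
    \sum_j r j *: real_vec R (gvec S (q j)) ->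
  nonzero (q i).1 -> nonzero M -> jasso others M -> ~ hom_zero (q i).1 M.
Proof.
rewrite -scaleNr => vE nzA nzM JM hM.
have [t t_gt0] := relation_split nzM vE; rewrite others_sum0 // addr0 => tE.
have [t' t'_gt0 t'E] := relation_split nzA vE.
have aM : a M i <= 0 by rewrite /a lerz0 euler_le0.
have aA j : 0 <= a (q i).1 j.
  by rewrite /a ler0z; apply/euler_ge0/complete_hom_zero.
have sum_ge0 : 0 <= \sum_(j | j != i) r j * a (q i).1 j.
  by apply: sumr_ge0 => j _; rewrite mulr_ge0 // ltW.
have et := mulr_gt0 e_gt0 t_gt0; have et' := mulr_gt0 e_gt0 t'_gt0.
have := aA i; have ri := r_gt0 i.
have [r1 | r1] := lerP (r i) 1; first by nra.
by nra.
Qed.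

(** The mirror image of the previous argument, with B_i as the second test
    module: all the Euler forms are at most 0 there. *)
Lemma hom_nonzero_below M :
  real_vec R (gvec S p) + e *: Defs.eta R n =
    \sum_j r j *: real_vec R (gvec S (q j)) ->
  nonzero (q i).2 -> nonzero M -> jasso others M -> ~ hom_zero M (q i).2.
Proof.
move=> vE nzB nzM JM hM.
have [t t_gt0] := relation_split nzM vE; rewrite others_sum0 // addr0 => tE.
have [t' t'_gt0 t'E] := relation_split nzB vE.
have aM : 0 <= a M i by rewrite /a ler0z euler_ge0.
have aB j : a (q i).2 j <= 0.
  by rewrite /a lerz0; apply/euler_le0/complete_hom_zero.
have sum_le0 : \sum_(j | j != i) r j * a (q i).2 j <= 0.
  by apply: sumr_le0 => j _; rewrite mulr_ge0_le0 // ltW.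
have et := mulr_gt0 e_gt0 t_gt0; have et' := mulr_gt0 e_gt0 t'_gt0.
have := aB i; have ri := r_gt0 i.
have [r1 | r1] := lerP (r i) 1; first by nra.
by nra.
Qed.

End Relation.

Lemma near_at_right0 (R : realType) (P : R -> Prop) :
  (\forall e \near (0 : R)^'+, P e)%classic -> exists2 e, 0 < e & P e.
Proof.
move=> nearP; have [e [e_gt0 Pe]] := filter_ex (filterI (nbhs_right_gt 0) nearP).
by exists e.
Qed.

Lemma iso_nonzero M N : iso M N -> nonzero N -> nonzero M.
Proof.
case=> f [_ ef] /nonzero_vec[y y0]; apply/nonzero_vec.
have [x fx] := epi_surj y ef; exists x => x0.
by apply: y0; rewrite -fx x0 linear0.
Qed.

End Walls.

Theorem theorem0p6 (K : fieldType) (L : falgType K) (R : realType)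
    (n : nat) (S : 'I_n -> rmodule L)
    (simplesS : simple_representatives S) (n_ge2 : (2 <= n)%N)
    (p : mpair L) (p_indec : indecomposable_balanced p) :
  (nonzero p.1 ->
     forall M : rmodule L, covering_wall R S p M -> quotient_of M p.1) /\
  (nonzero p.2 ->
     forall M : rmodule L, flooring_wall R S p M -> submodule_of M p.2).
Proof.
have [balp _ _] := p_indec.
split=> [nzA M [q [i [cq iso_qp [_ _ near_up] wallM]]] |
         nzB M [q [i [cq iso_qp [_ _ near_low] wallM]]]];
  have [JM nzM _] := wallM; have [iso1 iso2] := iso_qp.
- have [e e_gt0 [r r_gt0 rE]] := near_at_right0 near_up.
  have /(jasso_simple_quotient cq wallM)[f ef] : ~ hom_zero (q i).1 M.
    apply: (hom_nonzero_above simplesS balp cq iso_qp r_gt0 e_gt0 rE) => //.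
    exact: iso_nonzero iso1 nzA.
  have [g [_ eg]] := iso_sym iso1.
  by exists (f \o g)%VF; apply: epi_comp.
have [e e_gt0 [r r_gt0 rE]] := near_at_right0 near_low.
have /(jasso_simple_submodule cq wallM)[f mf] : ~ hom_zero M (q i).2.
  apply: (hom_nonzero_below simplesS balp cq iso_qp r_gt0 e_gt0 rE) => //.
  exact: iso_nonzero iso2 nzB.
have [g [mg _]] := iso2.
by exists (g \o f)%VF; apply: mono_comp.
Qed.
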